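(* Let $T=C$ (the Cesàro operator) or $T=C^*$ (the Copson operator). Let $I=[0,1]$ or $I=[0,\infty)$. If $X$ is a Banach function space on $I$ such that $TX\ne\{0\}$, then the space $TX$ fails to have the fixed point property. Moreover, (i) the dual space $(TX)^*$ cannot be renormed (with any equivalent norm) to have the fixed point property; (ii) the dual space $(TX)^*$ fails to have the weak fixed point property.
   Context: $L^0(I)$ is the space of (a.e. equivalence classes of) real-valued Lebesgue measurable functions on $I$. A Banach function space $X$ on $I$ is a Banach space that is a linear subspace of $L^0(I)$ with the ideal property: $|f|\le|g|$ a.e., $f\in L^0(I)$, $g\in X$ imply $f\in X$ and $\|f\|_X\le\|g\|_X$; by convention $X$ is also assumed to contain a function positive a.e. on $I$ (this is not assumed for the derived space $TX$). Cesàro operator: $Cf(x)=\frac1x\int_0^x f(t)\,dt$ for $0<x\in I$. Copson operator: $C^*f(x)=\int_{I\cap[x,\infty)}\frac{f(t)}{t}\,dt$ for $x\in I$. $TX=\{f\in L^0(I): T|f|\in X\}$ with norm $\|f\|_{TX}=\|T|f|\|_X$. A Banach space $E$ has the fixed point property if for every nonempty closed bounded convex $K\subset E$, every nonexpansive map $S:K\to K$ ($\|S(x)-S(y)\|\le\|x-y\|$ for all $x,y\in K$) has a fixed point. $E$ has the weak fixed point property if this holds for every nonempty weakly compact convex $K\subset E$. *)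

(* Defs.v *)
From HB Require Import structures.
From mathcomp Require Import all_boot all_order all_algebra.
From mathcomp Require Import all_classical all_reals all_analysis.
From mathcomp Require Import measurable_realfun.
Set Implicit Arguments.
Unset Strict Implicit.
Unset Printing Implicit Defensive.
Import Order.TTheory GRing.Theory Num.Theory.
Import numFieldNormedType.Exports.
Local Open Scope classical_set_scope.
Local Open Scope ring_scope.

(* The real line with the sigma-algebra of Lebesgue measurable sets, the domain
   of [completed_lebesgue_measure]. *)
Notation lebesgueTypeR R := (caratheodory_type ((wlength (@idfun R))^*)%mu).
Local Notation leb := completed_lebesgue_measure.

Inductive domain := unit_interval | half_line.

Definition domain_set (R : realType) (I : domain) : set (lebesgueTypeR R) :=
  match I with
  | unit_interval => `[0, 1]
  | half_line => `[0, +oo[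
  end.
Arguments domain_set : clear implicits.

Section domain_theory.
Variable R : realType.

Lemma borel_lebesgue_measurable (A : set R) :
  measurable A -> measurable (A : set (lebesgueTypeR R)).
Proof. exact: sub_caratheodory. Qed.

Lemma borel_lebesgue_measurable_fun d (T : measurableType d) (D : set R)
    (f : R -> T) : measurable D ->
  measurable_fun D f -> @measurable_fun _ _ (lebesgueTypeR R) T D f.
Proof.
by move=> mD mf _ Y mY; apply: borel_lebesgue_measurable; exact: mf.
Qed.

Lemma measurable_domain_set (I : domain) : measurable (domain_set R I).
Proof. by case: I; apply: borel_lebesgue_measurable; exact: measurable_itv. Qed.

Definition lebesgue_on (I : domain) : set (lebesgueTypeR R) -> \bar R :=
  mrestr leb (measurable_domain_set I).

HB.instance Definition _ (I : domain) := Measure.on (lebesgue_on I).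

Lemma ae_lebesgue_onP (I : domain) (P : set R) :
  {ae lebesgue_on I, forall x, P x} <->
  {ae (@leb R), forall x, domain_set R I x -> P x}.
Proof.
split=> -[N [mN N0 PN]].
- exists (N `&` domain_set R I); split => //.
    by apply: measurableI => //; exact: measurable_domain_set.
  by move=> x /= /not_implyP[Ix Px]; split => //; exact: PN.
- exists (N `|` ~` domain_set R I); split => //.
  + apply: measurableU => //; apply: measurableC; exact: measurable_domain_set.
  + rewrite /lebesgue_on /mrestr setIUl setICl setU0.
    apply/eqP; rewrite eq_le measure_ge0 andbT -[leRHS]N0 le_measure ?inE//.
    by apply: measurableI => //; exact: measurable_domain_set.
  + move=> x /= Px; have [Ix|] := pselect (domain_set R I x); last by right.
    by left; apply: PN => /=; apply/not_implyP.
Qed.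

End domain_theory.
Arguments lebesgue_on : clear implicits.

(* Functions are defined on the whole line; only their values on I, up to a null
   set, matter. *)
Definition L0 (R : realType) (I : domain) : Type :=
  {mfun_ (lebesgue_on R I), lebesgueTypeR R >-> R}.

Section L0_lmodule.
Variables (R : realType) (I : domain).
Local Notation L := (L0 R I).
Local Notation mu := (lebesgue_on R I).
HB.instance Definition _ := Choice.on L.
HB.instance Definition _ := EqQuotient.on L.
Local Open Scope quotient_scope.

Definition L0_fun (f : L) : {mfun lebesgueTypeR R >-> R} := repr f.
Coercion L0_fun : L >-> MeasurableFun.type.

Lemma L0P (f g : L) : {ae mu, forall x, f x = g x} <-> f = g.
Proof.
split=> [fg|->]; last exact: nearW.
rewrite -[f]reprK -[g]reprK; apply/eqmodP/asboolP.
by apply: filterS fg => x + _.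
Qed.

Lemma L0_pi (f : {mfun lebesgueTypeR R >-> R}) :
  {ae mu, forall x, (\pi_L f : L) x = f x}.
Proof.
have /eqmodP/asboolP := reprK (\pi_L f).
by apply: filterS => x /(_ Logic.I).
Qed.

Definition L0_zero : L := \pi_L 0.
Definition L0_opp (f : L) : L := \pi_L (- (f : {mfun _ >-> _})).
Definition L0_add (f g : L) : L :=
  \pi_L ((f : {mfun _ >-> _}) + (g : {mfun _ >-> _})).
Definition L0_scale (a : R) (f : L) : L := \pi_L (a *: (f : {mfun _ >-> _})).

Let zeroE : {ae mu, forall x, L0_zero x = 0}.
Proof. exact: L0_pi. Qed.
Let oppE f : {ae mu, forall x, L0_opp f x = - f x}.
Proof. exact: L0_pi. Qed.
Let addE f g : {ae mu, forall x, L0_add f g x = f x + g x}.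
Proof. exact: L0_pi. Qed.
Let scaleE a f : {ae mu, forall x, L0_scale a f x = a * f x}.
Proof. exact: L0_pi. Qed.

Let addA : associative L0_add.
Proof.
move=> f g h; apply/L0P.
near=> x.
rewrite (near (addE f (L0_add g h)) x)// (near (addE g h) x)//.
by rewrite (near (addE (L0_add f g) h) x)// (near (addE f g) x)// addrA.
Unshelve. all: by end_near. Qed.

Let addC : commutative L0_add.
Proof.
move=> f g; apply/L0P; near=> x.
by rewrite (near (addE f g) x)// (near (addE g f) x)// addrC.
Unshelve. all: by end_near. Qed.

Let add0 : left_id L0_zero L0_add.
Proof.
move=> f; apply/L0P; near=> x.
by rewrite (near (addE _ f) x)// (near zeroE x)// add0r.
Unshelve. all: by end_near. Qed.

Let addN : left_inverse L0_zero L0_opp L0_add.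
Proof.
move=> f; apply/L0P; near=> x.
by rewrite (near (addE _ f) x)// (near zeroE x)// (near (oppE f) x)// addNr.
Unshelve. all: by end_near. Qed.

HB.instance Definition _ := GRing.isZmodule.Build L addA addC add0 addN.

Let scaleA a b f : L0_scale a (L0_scale b f) = L0_scale (a * b) f.
Proof.
apply/L0P; near=> x.
rewrite (near (scaleE a _) x)// (near (scaleE b f) x)//.
by rewrite (near (scaleE _ f) x)// mulrA.
Unshelve. all: by end_near. Qed.

Let scale1 : left_id 1 L0_scale.
Proof.
move=> f; apply/L0P; near=> x.
by rewrite (near (scaleE _ f) x)// mul1r.
Unshelve. all: by end_near. Qed.

Let scaleDr : right_distributive L0_scale +%R.
Proof.
move=> a f g; apply/L0P; near=> x.
rewrite (near (scaleE a (f + g)) x)// (near (addE f g) x)//.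
rewrite (near (addE (L0_scale a f) (L0_scale a g)) x)//.
by rewrite (near (scaleE a f) x)// (near (scaleE a g) x)// mulrDr.
Unshelve. all: by end_near. Qed.

Let scaleDl f : {morph L0_scale^~ f : a b / a + b}.
Proof.
move=> a b; apply/L0P; near=> x.
rewrite (near (scaleE (a + b) f) x)//.
rewrite (near (addE (L0_scale a f) (L0_scale b f)) x)//.
by rewrite (near (scaleE a f) x)// (near (scaleE b f) x)// mulrDl.
Unshelve. all: by end_near. Qed.

HB.instance Definition _ := GRing.Zmodule_isLmodule.Build R L
  scaleA scale1 scaleDr scaleDl.

Lemma L0_zeroE : {ae mu, forall x, (0 : L) x = 0}.
Proof. exact: zeroE. Qed.
Lemma L0_addE (f g : L) : {ae mu, forall x, (f + g : L) x = f x + g x}.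
Proof. exact: addE. Qed.
Lemma L0_scaleE a (f : L) : {ae mu, forall x, (a *: f : L) x = a * f x}.
Proof. exact: scaleE. Qed.

End L0_lmodule.

Inductive operator := Cesaro | Copson.

(* At x = 0, excluded in the definition of the Cesaro operator, the value is a
   junk one on a null set. *)
Definition averaging (R : realType) (T : operator) (I : domain)
    (f : R -> R) (x : R) : \bar R :=
  match T with
  | Cesaro => (x^-1)%:E * \int[leb]_(t in `[0%R, x]) (f t)%:E
  | Copson => \int[leb]_(t in domain_set R I `&` `[x, +oo[) (f t / t)%:E
  end%E.

Section averaging_theory.
Variables (R : realType) (T : operator) (I : domain).
Local Notation mu := (lebesgue_on R I).
Implicit Types (f g h : {mfun lebesgueTypeR R >-> R}) (x : R).

Definition averaging_set x : set (lebesgueTypeR R) :=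
  if T is Cesaro then `[0, x] else domain_set R I `&` `[x, +oo[.
Definition averaging_kernel (x t : R) : R := if T is Cesaro then x^-1 else t^-1.
Local Notation D := averaging_set.
Local Notation k := averaging_kernel.
Local Notation A f x := (averaging T I (fun t => `|f t|) x).

Lemma domain_set_ge0 x : domain_set R I x -> 0 <= x.
Proof. by case: I => /=; rewrite in_itv/= => /andP[]. Qed.

Let mD x : measurable (D x).
Proof.
rewrite /averaging_set; case: T; first by apply: borel_lebesgue_measurable; exact: measurable_itv.
apply: measurableI; first exact: measurable_domain_set.
by apply: borel_lebesgue_measurable; exact: measurable_itv.
Qed.

Let D_ge0 x t : D x t -> 0 <= t.
Proof.
rewrite /averaging_set; case: T => /=; first by rewrite in_itv/= => /andP[].
by case=> /domain_set_ge0.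
Qed.

Let D_dom x t : domain_set R I x -> D x t -> domain_set R I t.
Proof.
rewrite /averaging_set; case: T => /= [|_ []//]; case: I => /=; rewrite !in_itv/=.
  by move=> /andP[? x1] /andP[-> tx] /=; exact: le_trans x1.
by move=> _ /andP[->].
Qed.

Let measurable_inv : measurable_fun [set: lebesgueTypeR R] (@GRing.inv R).
Proof.
apply: (@borel_lebesgue_measurable_fun R _ _ setT) => //.
have o0 : open (~` [set (0 : R)]).
  by apply: closed_openC; exact/accessible_closed_set1/hausdorff_accessible/norm_hausdorff.
rewrite -(setvU [set (0 : R)]); apply/measurable_funU => //.
  exact: open_measurable.
split; last exact: measurable_fun_set1.
apply: open_continuous_measurable_fun => // x; rewrite inE/= => /eqP x0.
exact: inv_continuous.
Qed.

Let mk x : measurable_fun [set: lebesgueTypeR R] (k x).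
Proof. by rewrite /averaging_kernel; case: T; [exact: measurable_cst|exact: measurable_inv]. Qed.

Let k_ge0 x t : 0 < x -> D x t -> 0 <= k x t.
Proof.
by move=> x0 /D_ge0 t0; rewrite /averaging_kernel; case: T; rewrite invr_ge0// ltW.
Qed.

Let mkf x f : measurable_fun [set: lebesgueTypeR R] (fun t => (k x t * `|f t|)%:E).
Proof.
apply/measurable_EFinP; apply: measurable_funM; first exact: mk.
by apply: measurableT_comp.
Qed.

Let kf_ge0 x f t : 0 < x -> D x t -> (0 <= (k x t * `|f t|)%:E)%E.
Proof. by move=> x0 Dt; rewrite lee_fin mulr_ge0// k_ge0. Qed.

Let AE f x : 0 < x -> A f x = (\int[leb]_(t in D x) (k x t * `|f t|)%:E)%E.
Proof.
move=> x0; rewrite /averaging /averaging_set /averaging_kernel; case: T; last first.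
  by apply: eq_integral => t _; rewrite mulrC.
have mI : measurable (`[0, x] : set (lebesgueTypeR R)).
  by apply: borel_lebesgue_measurable; exact: measurable_itv.
have mf : measurable_fun (`[0, x] : set (lebesgueTypeR R)) (fun t => (`|f t|)%:E).
  by apply/measurable_EFinP; apply: measurable_funTS; exact: measurableT_comp.
apply/esym; transitivity (\int[leb]_(t in `[0%R, x]) ((x^-1)%:E * (`|f t|)%:E))%E.
  by [].
by rewrite (ge0_integralZl leb mI mf)// lee_fin invr_ge0 ltW.
Qed.

Let mkfD x f : measurable_fun (D x) (fun t => (k x t * `|f t|)%:E).
Proof. exact: measurable_funTS. Qed.

Lemma averaging_ge0 f x : 0 < x -> (0 <= A f x)%E.
Proof. by move=> x0; rewrite AE//; apply: integral_ge0 => t; exact: kf_ge0. Qed.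

Lemma le_averaging f g h x : domain_set R I x -> 0 < x ->
  {ae mu, forall t, `|f t| <= `|g t| + `|h t|} -> (A f x <= A g x + A h x)%E.
Proof.
move=> Ix x0 /ae_lebesgue_onP fgh; rewrite !AE// -ge0_integralD//; first last.
- by move=> t; exact: kf_ge0.
- by move=> t; exact: kf_ge0.
apply: ae_ge0_le_integral.
- exact: mD.
- by move=> t; exact: kf_ge0.
- exact: mkfD.
- by move=> t Dt; rewrite adde_ge0// kf_ge0.
- by apply: emeasurable_funD; exact: mkfD.
apply: filterS fgh => t + Dt; move=> /(_ (D_dom Ix Dt)) fgh.
by rewrite -EFinD lee_fin -mulrDr ler_wpM2l// k_ge0.
Qed.

Lemma averagingZ f g (a : R) x : domain_set R I x -> 0 < x ->
  {ae mu, forall t, g t = a * f t} -> A g x = (`|a|%:E * A f x)%E.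
Proof.
move=> Ix x0 /ae_lebesgue_onP gf; rewrite !AE// -ge0_integralZl//; last first.
  by move=> t; exact: kf_ge0.
apply: ge0_ae_eq_integral.
- exact: mD.
- exact: mkfD.
- by apply: emeasurable_funM; [exact: measurable_cst|exact: mkfD].
- by move=> t; exact: kf_ge0.
- by move=> t Dt; rewrite mule_ge0// kf_ge0.
apply: filterS gf => t + Dt; move=> /(_ (D_dom Ix Dt)) ->.
by rewrite -EFinM normrM mulrCA.
Qed.


Lemma averaging_eq0 f x : domain_set R I x -> 0 < x -> A f x = 0%E ->
  {ae mu, forall t, D x t -> f t = 0}.
Proof.
move=> Ix x0; rewrite AE// => Af0; apply/ae_lebesgue_onP.
have : (\int[leb]_(t in D x) `|(k x t * `|f t|)%:E|)%E = 0%E.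
  rewrite -Af0; apply: eq_integral => t; rewrite inE => Dt.
  by rewrite gee0_abs// kf_ge0.
move/(ae_eq_integral_abs leb (mD x) (@mkfD x f)).
have : {ae (@leb R), forall t : lebesgueTypeR R, t <> 0}.
  exists [set 0]; split.
  - by apply: borel_lebesgue_measurable; exact: measurable_set1.
  - exact: (@lebesgue_measure_set1 R 0).
  - by move=> t /= /contrapT.
apply: filterS2 => t t0 kf0 It Dt; move/(_ Dt): kf0 => /= [] /eqP.
rewrite mulf_eq0 normr_eq0 => /orP[|/eqP//].
rewrite /averaging_kernel; case: T; rewrite invr_eq0.
  by rewrite gt_eqF.
by move/eqP.
Qed.

Lemma ae_lebesgue_on_itv (P : set R) (a b : R) : a < b ->
  `]a, b[ `<=` domain_set R I -> {ae mu, forall x, P x} ->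
  exists2 x, x \in `]a, b[ & P x.
Proof.
move=> ab abI /ae_lebesgue_onP [N [mN N0 PN]].
apply: contrapT => noP.
have abN : `]a, b[ `<=` N.
  move=> x abx; apply: PN => /= /(_ (abI _ abx)) Px; apply: noP; exists x => //.
have : (leb (`]a, b[ : set (lebesgueTypeR R)) <= leb N)%E.
  apply: le_measure => //; rewrite inE//.
  by apply: borel_lebesgue_measurable; exact: measurable_itv.
rewrite N0; have -> : leb `]a, b[%classic = (b - a)%:E.
  by have := lebesgue_measure_itv `]a, b[; rewrite /= lte_fin ab -EFinD.
by rewrite lee_fin leNgt subr_gt0 ab.
Qed.

Let exhaust (n : nat) : R * R :=
  match T, I with
  | Cesaro, unit_interval => (1 - n.+2%:R^-1, 1)
  | Cesaro, half_line => (n%:R, n.+1%:R)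
  | Copson, _ => (0, n.+1%:R^-1)
  end.

Let exhaust_lt n : (exhaust n).1 < (exhaust n).2.
Proof.
rewrite /exhaust; case: T; case: I => /=; rewrite ?ltr_nat ?invr_gt0//.
Qed.

Let exhaust_dom n x : x \in `](exhaust n).1, (exhaust n).2[ ->
  domain_set R I x /\ 0 < x.
Proof.
rewrite /exhaust; case: T; case: I => /=; rewrite !in_itv/= => /andP[x0 x1].
- have xp : 0 < x.
    by rewrite (le_lt_trans _ x0)// subr_ge0 invf_le1// ler1n.
  by rewrite !ltW.
- have xp : 0 < x by rewrite (le_lt_trans _ x0).
  by rewrite ltW.
- by rewrite !ltW// (lt_le_trans x1)// invf_le1// ler1n.
- by rewrite ltW.
Qed.

Let exhaustE t (xs : nat -> R) : domain_set R I t -> t != 0 -> t != 1 ->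
  (forall n, xs n \in `](exhaust n).1, (exhaust n).2[) ->
  exists n, D (xs n) t.
Proof.
move=> It t0 t1 xsP.
have tp : 0 < t by rewrite lt_neqAle eq_sym t0 domain_set_ge0.
have small (r : R) : 0 < r -> exists n, n.+1%:R^-1 < r.
  by move=> r0; have [n _ H] := near_infty_natSinv_lt (PosNum r0); exists n; apply: H => /=.
move: xsP; rewrite /exhaust /averaging_set; move: It; case: T; case: I => /=.
- rewrite in_itv/= => /andP[_ tle1] xsP.
  have [|n nt] := small (1 - t); first by rewrite subr_gt0 lt_neqAle t1.
  exists n; have := xsP n; rewrite !in_itv/= ltW//= => /andP[xn _].
  rewrite ltW// (lt_trans _ xn)// ltrBrDr -ltrBrDl (lt_trans _ nt)//.
  by rewrite ltf_pV2 ?posrE ?ltr0n// ltr_nat.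
- move=> _ xsP; exists (Num.truncn t).+1.
  have := xsP (Num.truncn t).+1; rewrite !in_itv/= (ltW tp)/= => /andP[xn _].
  by rewrite ltW// (lt_trans _ xn)// truncnS_gt.
- move=> It xsP; have [n nt] := small _ tp; exists n; split => //.
  by have := xsP n; rewrite !in_itv/= andbT => /andP[_ /lt_trans/(_ nt)/ltW].
- move=> It xsP; have [n nt] := small _ tp; exists n; split => //.
  by have := xsP n; rewrite !in_itv/= andbT => /andP[_ /lt_trans/(_ nt)/ltW].
Qed.

Lemma averaging_ae_eq0 f : {ae mu, forall x, A f x = 0%E} ->
  {ae mu, forall x, f x = 0}.
Proof.
move=> Af0.
have /choice[xs xsP] n : exists x,
    (x \in `](exhaust n).1, (exhaust n).2[) /\ A f x = 0%E.
  have [|x xe Ax] := ae_lebesgue_on_itv (exhaust_lt n) _ Af0; last by exists x.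
  by move=> x /exhaust_dom[].
have : {ae mu, forall t, forall n, D (xs n) t -> f t = 0}.
  apply: ae_foralln => n; have [/exhaust_dom[Ix x0] Ax] := xsP n.
  exact: averaging_eq0.
move=> /ae_lebesgue_onP H; apply/ae_lebesgue_onP.
have ae_neq (a : R) : {ae (@leb R), forall t : lebesgueTypeR R, t != a}.
  exists [set a]; split.
  - by apply: borel_lebesgue_measurable; exact: measurable_set1.
  - exact: (@lebesgue_measure_set1 R a).
  - by move=> t /= /negP/negPn/eqP.
move: H (ae_neq 0) (ae_neq 1); apply: filterS3 => t H t0 t1 It.
have [|n Dn] := exhaustE It t0 t1 (xs := xs); first by move=> n; have [] := xsP n.
exact: H Dn.
Qed.

Lemma nondecreasing_measurable_ereal (g : R -> \bar R) :
  {homo g : x y / x <= y >-> (x <= y)%E} ->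
  measurable_fun [set: lebesgueTypeR R] g.
Proof.
move=> gh; apply: (@borel_lebesgue_measurable_fun R _ _ setT) => //.
apply: (measurability (@ErealGenCInfty.G R)).
  exact: ErealGenCInfty.measurableE.
move=> /= _ [_ [r ->] <-]; apply: measurableI => //.
apply: is_interval_measurable => s t/=.
rewrite !in_itv/= !andbT => rs rt u /andP[su ut].
by rewrite in_itv/= andbT (le_trans rs)// gh.
Qed.


Lemma measurable_averaging f :
  measurable_fun [set: lebesgueTypeR R] (fun x => A f x).
Proof.
rewrite /averaging; case: T.
  apply: emeasurable_funM; first exact/measurable_EFinP.
  apply: nondecreasing_measurable_ereal => x y xy.
  apply: ge0_subset_integral.
  - by apply: borel_lebesgue_measurable; exact: measurable_itv.
  - by apply: borel_lebesgue_measurable; exact: measurable_itv.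
  - by apply/measurable_EFinP; apply: measurable_funTS; exact: measurableT_comp.
  - by move=> t _; rewrite lee_fin.
  - by move=> t /=; rewrite !in_itv/= => /andP[-> /le_trans]; apply.
set g := fun _ => _.
have -> : g = (fun x => - - g x)%E by apply/funext => x; rewrite oppeK.
apply: measurableT_comp; first exact: oppe_measurable.
apply: nondecreasing_measurable_ereal => x y xy; rewrite leeN2.
have mI z : measurable (domain_set R I `&` (`[z, +oo[ : set (lebesgueTypeR R))).
  apply: measurableI; first exact: measurable_domain_set.
  by apply: borel_lebesgue_measurable; exact: measurable_itv.
apply: ge0_subset_integral.
- exact: mI.
- exact: mI.
- apply/measurable_EFinP; apply: measurable_funTS; apply: measurable_funM; last exact: measurable_inv.
  exact: measurableT_comp.
- by move=> t [/domain_set_ge0 t0 _]; rewrite lee_fin divr_ge0.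
- by move=> t /= [It]; rewrite !in_itv/= !andbT => /(le_trans xy).
Qed.

End averaging_theory.

(* The Banach space [X], presented by its inclusion [bfs_val] in [L0 R I]. *)
Record banachFunctionSpace (R : realType) (I : domain) := BanachFunctionSpace {
  bfs_sort :> completeNormedModType R ;
  bfs_val : {linear bfs_sort -> L0 R I} ;
  bfs_val_inj : injective bfs_val ;
  bfs_ideal : forall (f : L0 R I) (g : bfs_sort),
    {ae lebesgue_on R I, forall x, `|f x| <= `|(bfs_val g : L0 R I) x|} ->
    exists2 h : bfs_sort, bfs_val h = f & `|h| <= `|g| ;
  bfs_positive : exists g : bfs_sort,
    {ae lebesgue_on R I, forall x, 0 < (bfs_val g : L0 R I) x}
}.
Arguments bfs_val {R I b}.

Section TX_definition.
Variables (R : realType) (I : domain) (T : operator).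
Variable X : banachFunctionSpace R I.
Local Notation mu := (lebesgue_on R I).

(* T|f| = u; in particular T|f| is finite almost everywhere. *)
Definition TX_image (f : L0 R I) (u : X) :=
  {ae mu, forall x : lebesgueTypeR R, averaging T I (fun t => `|f t|) x = ((bfs_val u : L0 R I) x)%:E}.

Definition TX_pred : {pred L0 R I} :=
  [pred f | `[< exists u : X, TX_image f u >] ].

Lemma TX_image_inj f u v : TX_image f u -> TX_image f v -> u = v.
Proof.
move=> fu fv; apply: bfs_val_inj; apply/L0P.
by apply: filterS2 fu fv => x -> [].
Qed.

Let ae_gt0 : {ae mu, forall x : lebesgueTypeR R, domain_set R I x /\ 0 < x}.
Proof.
apply/ae_lebesgue_onP.
have : {ae (@leb R), forall t : lebesgueTypeR R, t != 0}.
  exists [set 0]; split.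
  - by apply: borel_lebesgue_measurable; exact: measurable_set1.
  - exact: (@lebesgue_measure_set1 R 0).
  - by move=> t /= /negP/negPn/eqP.
by apply: filterS => x x0 Ix; split=> //; rewrite lt_neqAle eq_sym x0 (domain_set_ge0 Ix).
Qed.

Lemma TX_imageZ a f u : TX_image f u -> TX_image (a *: f) (`|a| *: u).
Proof.
move=> fu; rewrite /TX_image linearZ.
near=> x.
have [Ix x0] : domain_set R I x /\ 0 < x by near: x.
rewrite (averagingZ T Ix x0 (L0_scaleE a f)) (near fu x)//.
by rewrite (near (L0_scaleE `|a| (bfs_val u)) x)// EFinM.
Unshelve. all: by end_near. Qed.

Lemma TX_imageD f g u v : TX_image f u -> TX_image g v ->
  exists2 w, TX_image (f + g) w & `|w| <= `|u + v|.
Proof.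
move=> fu gv.
pose B := averaging T I (fun t => `|(f + g : L0 R I) t|).
pose h x := fine (B x).
have mh : measurable_fun [set: lebesgueTypeR R] h.
  apply: measurableT_comp; first exact: fine_measurable.
  exact: measurable_averaging.
pose mh' := isMeasurableFun.Build _ _ (lebesgueTypeR R) R h mh.
pose hm : {mfun lebesgueTypeR R >-> R} :=
  HB.pack_for {mfun lebesgueTypeR R >-> R} (h : lebesgueTypeR R -> R) mh'.
pose H : L0 R I := (\pi_(L0 R I) hm)%qT.
have HE : {ae mu, forall x : lebesgueTypeR R, B x = (H x)%:E
  /\ 0 <= H x <= (bfs_val (u + v) : L0 R I) x}.
  rewrite linearD.
  near=> x.
  have [Ix x0] : domain_set R I x /\ 0 < x by near: x.
  have leA : (B x <=
              ((bfs_val u : L0 R I) x + (bfs_val v : L0 R I) x)%R%:E)%E.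
    rewrite EFinD -(near fu x)// -(near gv x)//; apply: le_averaging => //.
    by apply: filterS (L0_addE f g) => t ->; exact: ler_normD.
  have A0 : (0%R <= B x)%E.
    exact: averaging_ge0.
  have HxE : B x = (H x)%:E.
    rewrite (near (L0_pi I hm) x)//= fineK// ge0_fin_numE//.
    by rewrite (le_lt_trans leA)// ltry.
  split => //.
  rewrite (near (L0_addE (bfs_val u) (bfs_val v)) x)//.
  by rewrite -!lee_fin -HxE A0 leA.
have [|w wH wle] := @bfs_ideal _ _ _ H (u + v).
  apply: filterS HE => x [_ /andP[H0 Hle]].
  by rewrite !ger0_norm// (le_trans H0).
exists w => //; rewrite /TX_image wH.
by apply: filterS HE => x [].
Unshelve. all: by end_near. Qed.

Lemma TX_image_eq0 f : TX_image f 0 -> f = 0.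
Proof.
move=> f0; apply/L0P.
have : {ae mu, forall x, f x = 0}.
  apply: (averaging_ae_eq0 (T := T)).
  move: f0 (L0_zeroE R I); rewrite /TX_image linear0.
  by apply: filterS2 => x -> ->.
by move: (L0_zeroE R I); apply: filterS2 => x -> ->.
Qed.

Lemma TX_predP f : reflect (exists u : X, TX_image f u) (f \in TX_pred).
Proof. exact: asboolP. Qed.

Lemma TX_submod_closed : submod_closed TX_pred.
Proof.
split.
  apply/TX_predP; exists 0.
  have := L0_scaleE 0 (0 : L0 R I).
  rewrite scale0r /TX_image linear0 => H.
  near=> x.
  have [Ix x0] : domain_set R I x /\ 0 < x by near: x.
  by rewrite (averagingZ T Ix x0 H) normr0 mul0e (near (L0_zeroE R I) x).
move=> a f g /TX_predP[u /(TX_imageZ a) fu] /TX_predP[v gv].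
by apply/TX_predP; have [w ? _] := TX_imageD fu gv; exists w.
Unshelve. all: by end_near. Qed.

HB.instance Definition _ :=
  GRing.isSubmodClosed.Build R (L0 R I) TX_pred TX_submod_closed.

Record TX := MkTX { TX_val :> L0 R I ; TX_valP : TX_val \in TX_pred }.

HB.instance Definition _ := [isSub for TX_val].
HB.instance Definition _ := [Choice of TX by <:].
HB.instance Definition _ := [SubChoice_isSubLmodule of TX by <:].

Definition TX_T (f : TX) : X := sval (cid (TX_predP _ (TX_valP f))).

Lemma TX_TP (f : TX) : TX_image f (TX_T f).
Proof. exact: svalP (cid _). Qed.

(* ||f||_TX = ||T|f| ||_X *)
Definition TX_norm (f : TX) : R := `|TX_T f|.

Let TX_normD f g : TX_norm (f + g) <= TX_norm f + TX_norm g.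
Proof.
have [w fgw wle] := TX_imageD (TX_TP f) (TX_TP g).
rewrite /TX_norm (TX_image_inj (TX_TP (f + g)) fgw).
exact: le_trans wle (ler_normD _ _).
Qed.

Let TX_normZ a f : TX_norm (a *: f) = `|a| * TX_norm f.
Proof.
rewrite /TX_norm (TX_image_inj (TX_TP (a *: f)) (TX_imageZ a (TX_TP f))).
by rewrite normrZ normr_id.
Qed.

Let TX_norm0_eq0 f : TX_norm f = 0 -> f = 0.
Proof.
move=> /normr0_eq0 f0; apply: val_inj; apply: TX_image_eq0.
by rewrite -f0; exact: TX_TP.
Qed.

HB.instance Definition _ :=
  Lmodule_isNormed.Build R TX TX_normD TX_normZ TX_norm0_eq0.

End TX_definition.

Section dual_space.
Variables (R : realType) (E : normedModType R).

Definition dual_pred : {pred E -> R^o} :=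
  [pred f : E -> R^o | `[< linear f /\ continuous f >] ].

Lemma dual_predP (f : E -> R^o) :
  reflect (linear f /\ continuous f) (f \in dual_pred).
Proof. exact: asboolP. Qed.

Lemma dual_submod_closed : submod_closed dual_pred.
Proof.
split.
  by apply/dual_predP; split=> [a x y|x]; [rewrite scaler0 addr0|exact: cvg_cst].
move=> a f g /dual_predP[lf cf] /dual_predP[lg cg].
apply/dual_predP; split=> [b x y|x].
  rewrite !fctE lf lg !scalerDr !scalerA (mulrC a b).
  by rewrite -!addrA; congr (_ + _); rewrite addrCA.
by apply: cvgD; [apply: cvgZr; exact: cf|exact: cg].
Qed.

HB.instance Definition _ :=
  GRing.isSubmodClosed.Build R (E -> R^o) dual_pred dual_submod_closed.

Record dual := MkDual { dual_val :> E -> R^o ; dual_valP : dual_val \in dual_pred }.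

HB.instance Definition _ := [isSub for dual_val].
HB.instance Definition _ := [Choice of dual by <:].
HB.instance Definition _ := [SubChoice_isSubLmodule of dual by <:].

Definition dual_norm (f : dual) : R :=
  sup [set `|f x| | x in [set x : E | `|x| <= 1]].

Let dual_linear (f : dual) : linear f.
Proof. by have /dual_predP[] := dual_valP f. Qed.

Let dual_continuous (f : dual) : continuous f.
Proof. by have /dual_predP[] := dual_valP f. Qed.

Let dualZ (f : dual) a x : f (a *: x) = a * f x.
Proof.
have f0 : f 0 = 0.
  by have := dual_linear f (-1) 0 0; rewrite scaler0 addr0 scaleN1r addNr.
by have := dual_linear f a x 0; rewrite !addr0 f0 addr0.
Qed.

Let dual_has_sup (f : dual) :
  has_sup [set `|f x| | x in [set x : E | `|x| <= 1]].
Proof.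
split; first by exists `|f 0|; exists 0 => //=; rewrite normr0.
pose g : {linear E -> R^o} :=
  HB.pack_for {linear E -> R^o} (f : E -> R^o)
    (GRing.isLinear.Build R E R^o *:%R f (dual_linear f)).
have /linear_boundedP : bounded_near g (nbhs (0 : E)).
  by apply/linear_bounded_continuous; exact: dual_continuous.
move=> /pinfty_ex_gt0[r r0 fr]; exists r => _ [x /= x1 <-].
by rewrite (le_trans (fr x))// ler_piMr// ltW.
Qed.

Lemma dual_norm_ge (f : dual) x : `|f x| <= dual_norm f * `|x|.
Proof.
have [->|x0] := eqVneq x 0.
  have := dualZ f 0 0; rewrite scaler0 mul0r => ->.
  by rewrite !normr0 mulr0.
have nx : 0 < `|x| by rewrite normr_gt0.
rewrite -ler_pdivrMr//.
have -> : `|f x| / `|x| = `|f (`|x|^-1 *: x)|.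
  by rewrite dualZ normrM normfV normr_id mulrC.
apply: sup_ubound; first by have [] := dual_has_sup f.
by exists (`|x|^-1 *: x) => //=; rewrite normrZ normfV normr_id mulVf// gt_eqF.
Qed.

Lemma dual_norm_le (f : dual) (M : R) :
  (forall x, `|x| <= 1 -> `|f x| <= M) -> dual_norm f <= M.
Proof.
move=> fM; apply: ge_sup; first by have [] := dual_has_sup f.
by move=> _ [x /= x1 <-]; exact: fM.
Qed.

Lemma dual_norm_ge0 (f : dual) : 0 <= dual_norm f.
Proof.
rewrite (le_trans (normr_ge0 (f 0)))//.
apply: sup_ubound; first by have [] := dual_has_sup f.
by exists 0 => //=; rewrite normr0.
Qed.

Let dual_normD f g : dual_norm (f + g) <= dual_norm f + dual_norm g.
Proof.
apply: dual_norm_le => x x1.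
rewrite (le_trans (ler_normD (f x) (g x)))// lerD//.
  by rewrite (le_trans (dual_norm_ge f x))// ler_piMr// dual_norm_ge0.
by rewrite (le_trans (dual_norm_ge g x))// ler_piMr// dual_norm_ge0.
Qed.

Let dual_normZ_le a f : dual_norm (a *: f) <= `|a| * dual_norm f.
Proof.
apply: dual_norm_le => x x1.
rewrite [X in `|X|](_ : _ = a * f x)// normrM ler_wpM2l//.
by rewrite (le_trans (dual_norm_ge f x))// ler_piMr// dual_norm_ge0.
Qed.

Let dual_normZ a f : dual_norm (a *: f) = `|a| * dual_norm f.
Proof.
apply/eqP; rewrite eq_le dual_normZ_le/=.
have [->|a0] := eqVneq a 0; first by rewrite normr0 mul0r dual_norm_ge0.
rewrite -ler_pdivlMl ?normr_gt0// -normfV.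
by rewrite -[X in dual_norm X <= _](scalerK a0) dual_normZ_le.
Qed.

Let dual_norm0_eq0 f : dual_norm f = 0 -> f = 0.
Proof.
move=> f0; apply: val_inj; apply/funext => x.
apply/eqP; rewrite -normr_le0.
by rewrite (le_trans (dual_norm_ge f x))// f0 mul0r.
Qed.

HB.instance Definition _ :=
  Lmodule_isNormed.Build R dual dual_normD dual_normZ dual_norm0_eq0.

End dual_space.

(* The weak topology of E: the initial topology of all the elements of its
   dual. *)
Definition weak_topology (R : realType) (E : normedModType R) : Type :=
  initial_topology (fun (x : E) => (fun f : dual E => f x) : {ptws dual E -> R}).
HB.instance Definition _ (R : realType) (E : normedModType R) :=
  Topological.on (weak_topology E).

Definition weakly_compact (R : realType) (E : normedModType R) (K : set E) :=
  compact (K : set (weak_topology E)).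

Section fixed_point_property.
Variables (R : realType) (E : normedModType R).

Definition nonexpansive_fixpoint (K : set E) :=
  forall S : E -> E, (forall x, K x -> K (S x)) ->
    (forall x y, K x -> K y -> `|S x - S y| <= `|x - y|) ->
    exists2 x, K x & S x = x.

Definition fixed_point_property :=
  forall K : set E, K !=set0 -> closed K -> bounded_set K ->
    convex_set (K : set (convex_lmodType E)) -> nonexpansive_fixpoint K.

Definition weak_fixed_point_property :=
  forall K : set E, K !=set0 -> weakly_compact K ->
    convex_set (K : set (convex_lmodType E)) -> nonexpansive_fixpoint K.

End fixed_point_property.
Arguments fixed_point_property {R} E.
Arguments weak_fixed_point_property {R} E.

Record equivalent_norm (R : realType) (E : normedModType R) := EquivalentNorm {
  eqnorm :> E -> R ;
  eqnormD : forall x y, eqnorm (x + y) <= eqnorm x + eqnorm y ;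
  eqnormZ : forall (a : R) x, eqnorm (a *: x) = `|a| * eqnorm x ;
  eqnorm_equiv : exists c C : R, [/\ 0 < c, 0 < C &
    forall x, c * `|x| <= eqnorm x <= C * `|x| ]
}.

(* E endowed with the equivalent norm N. *)
Definition renormed (R : realType) (E : normedModType R)
  (N : equivalent_norm E) : Type := E.

Section renormed.
Variables (R : realType) (E : normedModType R) (N : equivalent_norm E).

HB.instance Definition _ := GRing.Lmodule.copy (renormed N) E.

Let eqnorm0_eq0 (x : renormed N) : eqnorm N x = 0 -> x = 0.
Proof.
have [c [C [c0 _ /(_ x)/andP[cx _]]]] := eqnorm_equiv N => x0.
by apply/eqP; rewrite -normr_le0 -(pmulr_rle0 _ c0) -x0.
Qed.

HB.instance Definition _ := Lmodule_isNormed.Build R (renormed N)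
  (eqnormD N) (eqnormZ N) eqnorm0_eq0.

End renormed.

(* Main.v *)
Require Import Defs.
From HB Require Import structures.
From mathcomp Require Import all_boot all_order all_algebra.
From mathcomp Require Import all_classical all_reals all_analysis.
From mathcomp Require Import measurable_realfun.
From mathcomp Require Import ring lra.
Import Order.TTheory GRing.Theory Num.Theory.
Import numFieldNormedType.Exports.
Local Open Scope classical_set_scope.
Local Open Scope ring_scope.

(** The space TX contains an asymptotically isometric copy of l1, and its dual an
    isometric copy of l_infty; the three failures follow from these two facts.

    Both operators have the form T|f|(x) = eta(x) * integral of |f|/omega over D(x),
    where D(x) is [0, x], or the part of I beyond x, and is monotone in x. A nonzero f
    in TX yields an interior point p such that T|f| dominates a multiple of eta for
    all x beyond p; by the ideal property, eta cut off before b is an element of X for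
    every b beyond p ([profile_exists]). Take points b_0 = p, b_1, b_2, ... that tend
    monotonically to some q beyond p, let J_n be the interval between b_n and b_(n+1),
    and let u_n be eta cut off before b_n. If g has mass 1 in J_n (for dt/omega) then
    T|g| vanishes before b_n and equals eta beyond b_(n+1). The norms of the u_n
    decrease to a limit phi > 0, and on passing to a subsequence they converge as fast
    as desired ([profile_sequence]). Hence normalized functions f_n on the cells J_n
    satisfy phi * sum |a_n| <= |sum a_n f_n| and |f_n| <= |u_n|: an asymptotically
    isometric copy of l1. Moreover phi times the integration on the cells against a
    function constant on each of them is a functional of norm at most the supremum of
    the constants; if every value occurs on infinitely many cells there is equality,
    which embeds l_infty in the dual ([dual_linfty_embedding]).

    An asymptotically isometric copy of l1 refutes the fixed point property by the
    argument of Dowling and Lennard: a weighted simplex is closed, and the right shift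
    of the coefficients is nonexpansive on it without fixed point
    ([asymptotic_ell1_not_fpp]).

    Every renorming of l_infty contains such a copy. Indeed l_infty contains l1 over an
    uncountable set; the infimum of the new norm over the unit vectors of l1 with
    finite support outside a countable set A increases with A, hence becomes stationary
    at some A, and successive almost minimal vectors with disjoint supports outside A
    span the copy ([linfty_renormed_not_fpp]).

    Finally l_infty contains L1 of the Cantor space isometrically, where Alspach's map
    acts without fixed point on the weakly compact set of the functions with values
    in [0, 1] and integral 1/2. Such a function is represented by the martingale of its
    means on cylinders, the set being a closed subset of a product of intervals;
    that the weak topology is coarser than the product topology on it follows from a
    Banach-Saks argument ([banach_saks], [linfty_not_weak_fpp]). *)

Set Implicit Arguments.
Unset Strict Implicit.
Unset Printing Implicit Defensive.

(** * Asymptotically isometric copies of l1 *)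

(** The positive face of the unit sphere of l1. *)
Definition simplex (R : realType) (t : nat -> R) :=
  (forall n, 0 <= t n) /\ series t @ \oo --> (1 : R).

Section simplex.
Variable R : realType.
Implicit Types t : nat -> R.

Lemma simplex_sum_le1 t N : simplex t -> \sum_(0 <= n < N) t n <= 1.
Proof.
move=> [t0 t1]; have nd : nondecreasing_seq (series t).
  by apply: nondecreasing_series => n _ _; exact: t0.
by have := nondecreasing_cvgn_le nd (cvgP _ t1) N; rewrite (cvg_lim _ t1).
Qed.

Lemma simplex_vertex : simplex (fun n => (n == 0)%:R : R).
Proof.
split=> [n|]; first by case: (n == 0).
rewrite -cvg_shiftS; apply: cvg_near_cst; near=> n.
rewrite /series /= big_nat_recl//= big1 ?addr0// => i _.
Unshelve. all: by end_near. Qed.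

Lemma simplex_conv t s (a : R) : 0 <= a <= 1 -> simplex t -> simplex s ->
  simplex (fun n => a * t n + (1 - a) * s n).
Proof.
move=> /andP[a0 a1] [t0 t1] [s0 s1]; split=> [n|].
  by rewrite addr_ge0// mulr_ge0// subr_ge0.
have -> : series (fun n => a * t n + (1 - a) * s n) =
    (fun N => a * series t N + (1 - a) * series s N).
  apply/funext => N; rewrite /series /= big_split/=.
  by rewrite -!mulr_sumr.
have := cvgD (cvgM (cvg_cst a) t1) (cvgM (cvg_cst (1 - a)) s1).
rewrite !mulr1 (addrC a) subrK; exact.
Qed.

Definition shift_right t (n : nat) : R := if n is m.+1 then t m else 0.

Lemma series_shift_right t N : series (shift_right t) N.+1 = series t N.
Proof. by rewrite /series /= big_nat_recl//= add0r. Qed.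

Lemma simplex_shift_right t : simplex t -> simplex (shift_right t).
Proof.
move=> [t0 t1]; split=> [[|n]//=|].
rewrite -cvg_shiftS; apply: cvg_trans t1.
by under eq_fun do rewrite series_shift_right.
Qed.

End simplex.

Section right_shift.
Variables (R : realType) (E : normedModType R) (g : nat -> E).
Variables (lam : nat -> R) (c : R).
Hypothesis c_gt0 : 0 < c.
Hypothesis lam_ge : forall n, c <= lam n.
Hypothesis g_le : forall n, `|g n.+1| <= lam n.
Hypothesis g_lower : forall (a : nat -> R) N,
  \sum_(0 <= n < N) lam n * `|a n| <= `|\sum_(0 <= n < N) a n *: g n|.
Hypothesis g_cvg : forall t, simplex t -> cvgn (series (fun n => t n *: g n)).

Let lam_ge0 n : 0 <= lam n.
Proof. by rewrite (le_trans (ltW c_gt0)). Qed.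

Let B := `|g 0%N| + lam 0%N.

(** This is [g_lower] at the [n]th unit vector. *)
Let lam_le_g n : lam n <= `|g n|.
Proof.
have := g_lower (fun k => (k == n)%:R) n.+1.
rewrite !big_nat_recr//= eqxx normr1 mulr1 scale1r big_nat_cond big1; last first.
  by move=> i /andP[/andP[_ iN] _]; rewrite (ltn_eqF iN) normr0 mulr0.
rewrite [X in _ <= `|X + _|]big_nat_cond [X in _ <= `|X + _|]big1 ?add0r//.
by move=> i /andP[/andP[_ iN] _]; rewrite (ltn_eqF iN) scale0r.
Qed.

Let lam_le0 n : lam n <= lam 0%N.
Proof. by elim: n => // n; apply: le_trans; apply: le_trans (g_le n). Qed.

Let g_leB n : `|g n| <= B.
Proof.
case: n => [|n]; first by rewrite lerDl.
by rewrite (le_trans (g_le n))// (le_trans (lam_le0 n))// lerDr.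
Qed.

Let B_ge0 : 0 <= B. Proof. by rewrite addr_ge0. Qed.

Let sums (t : nat -> R) (z : E) := simplex t /\ series (fun n => t n *: g n) @ \oo --> z.
Let K : set E := [set z | exists t, sums t z].

Let seriesB t s N : series (fun n => t n *: g n) N - series (fun n => s n *: g n) N
  = \sum_(0 <= n < N) (t n - s n) *: g n.
Proof.
rewrite /series /= -sumrB; apply: eq_bigr => i _; by rewrite scalerBl.
Qed.

Let cvgB_norm t s z w : sums t z -> sums s w ->
  `|\sum_(0 <= n < N) (t n - s n) *: g n| @[N --> \oo] --> `|z - w|.
Proof.
move=> [_ tz] [_ sw]; apply: cvg_norm.
under eq_fun do rewrite -seriesB.
exact: cvgB.
Qed.

Let lower t s z w N : sums t z -> sums s w ->
  \sum_(0 <= n < N) lam n * `|t n - s n| <= `|z - w|.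
Proof.
move=> tz sw; apply: (cvgr_to_ge (cvgB_norm tz sw)).
near=> M; apply: le_trans (g_lower _ _).
have NM : (N <= M)%N by near: M; exact: nbhs_infty_ge.
rewrite (big_cat_nat _ NM)//= lerDl sumr_ge0// => i _.
by rewrite mulr_ge0.
Unshelve. all: by end_near. Qed.

Let upper t s z w L : sums t z -> sums s w ->
  (forall N, \sum_(0 <= n < N) `|g n| * `|t n - s n| <= L) -> `|z - w| <= L.
Proof.
move=> tz sw H; apply: (cvgr_to_le (cvgB_norm tz sw)).
near=> M; apply: le_trans (H M); apply: le_trans (ler_norm_sum _ _ _) _.
by apply: ler_sum => i _; rewrite normrZ mulrC.
Unshelve. all: by end_near. Qed.

Let sums_exists t : simplex t -> exists z, sums t z.
Proof.
move=> st; exists (lim (series (fun n => t n *: g n) @ \oo)).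
by split => //; exact: g_cvg.
Qed.

Let K_nonempty : K !=set0.
Proof.
have [z ?] := sums_exists (simplex_vertex R).
by exists z; exists (fun n => (n == 0)%:R).
Qed.

Let K_bounded : bounded_set K.
Proof.
exists B; split; first exact: num_real.
move=> M BM z [t [st tz]].
apply: (cvgr_to_le (cvg_norm tz)); near=> N.
rewrite (le_trans (ler_norm_sum _ _ _))//.
apply: (@le_trans _ _ (\sum_(0 <= n < N) t n * B)).
  by apply: ler_sum => i _; rewrite normrZ ger0_norm ?(st.1)// ler_wpM2l// st.1.
by rewrite -mulr_suml (le_trans _ (ltW BM))// ler_piMl// simplex_sum_le1.
Unshelve. all: by end_near. Qed.

Let K_convex : convex_set (K : set (convex_lmodType E)).
Proof.
move=> x y l; rewrite !inE => -[t [st tx]] [s [ss sy]].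
exists (fun n => l%:num * t n + (1 - l%:num) * s n); split.
  apply: simplex_conv => //.
  by rewrite ge0 le1.
have -> : conv l x y = l%:num *: (x : E) + (1 - l%:num) *: (y : E) by [].
have -> : series (fun n => (l%:num * t n + (1 - l%:num) * s n) *: g n) =
    (fun N => l%:num *: series (fun n => t n *: g n) N
              + (1 - l%:num) *: series (fun n => s n *: g n) N).
  apply/funext => N; rewrite /series /= !scaler_sumr -big_split/=.
  by apply: eq_bigr => i _; rewrite scalerDl !scalerA.
have := cvgD (cvgZ (cvg_cst l%:num) tx) (cvgZ (cvg_cst (1 - l%:num)) sy).
exact.
Qed.

Let coord_cauchy t s z w n : sums t z -> sums s w -> `|t n - s n| <= `|z - w| / c.
Proof.
move=> tz sw; rewrite ler_pdivlMr// (le_trans _ (lower n.+1 tz sw))//.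
rewrite big_nat_recr//= mulrC (le_trans (ler_wpM2r _ (lam_ge n)))//.
by rewrite lerDr sumr_ge0// => i _; rewrite mulr_ge0.
Qed.

(** The lower estimate turns norm convergence in [K] into l1 convergence of the
    coefficients, so that [K] is closed even if [E] is not complete: the only
    series that have to converge in [E] are those of [g_cvg]. *)
Let K_closed : closed K.
Proof.
move=> x Kx.
have /choice[zt ztP] k : exists zt : E * (nat -> R),
    sums zt.2 zt.1 /\ `|x - zt.1| < k.+1%:R^-1.
  have [|z [[t tz] xz]] := Kx (ball x k.+1%:R^-1).
    by apply: nbhsx_ballx; rewrite invr_gt0.
  by exists (z, t); split => //; move: xz; rewrite -ball_normE.
pose z k := (zt k).1; pose t k := (zt k).2.
have tz k : sums (t k) (z k) by have [] := ztP k.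
have zx k : `|x - z k| < k.+1%:R^-1 by have [] := ztP k.
have zz k j : `|z k - z j| <= k.+1%:R^-1 + j.+1%:R^-1.
  rewrite (_ : z k - z j = - (x - z k) + (x - z j)); last by rewrite opprB addrA subrK.
  by rewrite (le_trans (ler_normD _ _))// normrN lerD// ltW.
have inv_small (e : R) : 0 < e -> exists k : nat, forall j, (k <= j)%N -> j.+1%:R^-1 < e.
  move=> e0; have [k _ kP] := near_infty_natSinv_lt (PosNum e0).
  by exists k => j kj; exact: kP.
have tc n : cvgn (fun k => t k n).
  apply/cauchy_cvgP/cauchy_exP => e e0.
  have [|k kP] := inv_small (e * c / 2); first by rewrite divr_gt0// mulr_gt0.
  exists (t k n); exists k => // j /= kj; rewrite -ball_normE /=.
  rewrite (le_lt_trans (coord_cauchy n (tz k) (tz j)))// ltr_pdivrMr//.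
  rewrite (le_lt_trans (zz k j))// (splitr (e * c)) ltrD// kP//.
pose s n := limn (fun k => t k n).
have ts k N : \sum_(0 <= n < N) `|t k n - s n| <= k.+1%:R^-1 / c.
  have : \sum_(0 <= n < N) `|t k n - t j n| @[j --> \oo] -->
      \sum_(0 <= n < N) `|t k n - s n|.
    apply: cvg_big => [|n _]; first exact: add_continuous.
    apply: cvg_norm; apply: cvgB; [exact: cvg_cst|exact: tc].
  move=> H; apply: (@le_trans _ _ ((k.+1%:R^-1 + 0) / c)); last by rewrite addr0.
  apply: (ler_cvg_to H (g := fun j => (k.+1%:R^-1 + j.+1%:R^-1) / c)).
    by apply: cvgM; [apply: cvgD; [exact: cvg_cst|exact: cvg_harmonic]|exact: cvg_cst].
  near=> j; rewrite ler_pdivlMr// (le_trans _ (zz k j))//.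
  rewrite (le_trans _ (lower N (tz k) (tz j)))// mulr_suml ler_sum// => i _.
  by rewrite mulrC ler_wpM2r.
have ss : simplex s.
  split.
    move=> n; apply: (cvgr_to_ge (tc n)); near=> k.
    by have [[]] := tz k.
  apply/cvgrPdist_lt => e e0.
  have [|k kP] := inv_small (e * c / 2); first by rewrite divr_gt0// mulr_gt0.
  have [[_ /cvgrPdist_lt/(_ (e / 2))]] := tz k.
  rewrite divr_gt0// => /(_ isT) t1 _; near=> N.
  have tN : `|1 - series (t k) N| < e / 2 by near: N.
  rewrite (_ : 1 - _ = (1 - series (t k) N) + (series (t k) N - series s N)); last first.
    by rewrite addrA subrK.
  rewrite (le_lt_trans (ler_normD _ _))// (splitr e) ltrD//.
  rewrite (@le_lt_trans _ _ (k.+1%:R^-1 / c))//; last first.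
    by rewrite ltr_pdivrMr// mulrAC kP.
  apply: le_trans (ts k N); rewrite /series /= -sumrB; exact: ler_norm_sum.
have [y sy] := sums_exists ss.
exists s; suff -> : x = y by [].
apply/eqP; rewrite -subr_eq0 -normr_le0 leNgt; apply/negP => xy.
have [|k kP] := inv_small (`|x - y| / (1 + B / c)).
  by rewrite divr_gt0// ltr_pwDl// divr_ge0// ltW.
have Bc : 0 < 1 + B / c by rewrite ltr_pwDl// divr_ge0// ltW.
suff : `|x - y| <= k.+1%:R^-1 * (1 + B / c).
  by rewrite leNgt -ltr_pdivlMr// kP.
rewrite (_ : x - y = (x - z k) + (z k - y)); last by rewrite addrA subrK.
rewrite (le_trans (ler_normD _ _))// mulrDr mulr1 lerD//; first exact: ltW.
apply: (upper (tz k) sy) => N; rewrite [leRHS]mulrCA.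
apply: le_trans (_ : _ <= B * \sum_(0 <= n < N) `|t k n - s n|) _; last by rewrite ler_wpM2l.
by rewrite mulr_sumr ler_sum// => i _; rewrite ler_wpM2r.
Unshelve. all: by end_near. Qed.

(** On [K], the set of the sums of [t n *: g n] for [t] in the simplex, consider
    the right shift of the coefficients. It is nonexpansive because the weight
    [lam n] of the [n]th coordinate in the lower estimate dominates the norm of
    [g n.+1], and it has no fixed point because a shift-invariant sequence of
    coefficients vanishes. *)
Lemma right_shift_not_fpp : ~ fixed_point_property E.
Proof.
have /choice[tau tauP] z : exists t, K z -> sums t z.
  by have [[t tz]|nK] := pselect (K z); [exists t|exists (fun=> 0)].
have /choice[S SP] z : exists w, K z -> sums (shift_right (tau z)) w.
  have [Kz|nK] := pselect (K z); last by exists 0.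
  by have [w ?] := sums_exists (simplex_shift_right (tauP _ Kz).1); exists w.
move=> /(_ K K_nonempty K_closed K_bounded K_convex S) [z Kz||z Kz Sz].
- by exists (shift_right (tau z)); exact: SP.
- move=> x y Kx Ky; apply: (upper (SP x Kx) (SP y Ky)) => -[|N].
    by rewrite big_geq.
  rewrite big_nat_recl//= subrr normr0 mulr0 add0r.
  apply: le_trans (lower N (tauP x Kx) (tauP y Ky)).
  by apply: ler_sum => i _; rewrite ler_wpM2r.
- have tz := tauP z Kz; have := SP z Kz; rewrite Sz => sz.
  have t0 n : tau z n = 0.
    have eqn m : shift_right (tau z) m = tau z m.
      apply/eqP; rewrite -subr_eq0 -normr_le0.
      by rewrite (le_trans (coord_cauchy m sz tz))// subrr normr0 mul0r.
    by elim: n => [|n IH]; [exact/esym/(eqn 0%N)|rewrite -eqn].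
  have [[_ t1] _] := tz.
  have st0 : series (tau z) = fun=> 0.
    by apply/funext => N; rewrite /series /= big1.
  move: t1; rewrite st0 => /cvg_lim; rewrite lim_cst// => /(_ _)/esym/eqP.
  by rewrite oner_eq0 => /(_ (@Rhausdorff R)).
Qed.

End right_shift.

(** An asymptotically isometric copy of l1, up to the factor [mu], in the form used
    below for [TX] and for the renormings of its dual. The rate [1 / (n + 1)^2]
    is one for which the weights [1 + 1 / (n + 1)] decrease fast enough to absorb
    it, that is, (1 + 1 / (n + 2)) (1 + 1 / (n + 2)^2) <= 1 + 1 / (n + 1); the
    weighted vectors then fit [right_shift_not_fpp]. *)
Lemma asymptotic_ell1_not_fpp (R : realType) (E : normedModType R)
    (x : nat -> E) (mu : R) : 0 < mu ->
  (forall n, `|x n| <= mu * (1 + (n.+1%:R ^+ 2)^-1)) ->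
  (forall (a : nat -> R) N,
    mu * \sum_(0 <= n < N) `|a n| <= `|\sum_(0 <= n < N) a n *: x n|) ->
  (forall t : nat -> R, (exists2 r, (forall n, 0 <= t n) & forall N, series t N <= r) ->
    cvgn (series (fun n => t n *: x n))) ->
  ~ fixed_point_property E.
Proof.
move=> mu0 x_le x_lower x_cvg.
pose w n : R := 1 + n.+1%:R^-1.
have w_ge1 n : 1 <= w n by rewrite lerDl invr_ge0.
have w_ge0 n : 0 <= w n by rewrite (le_trans _ (w_ge1 n)).
apply: (@right_shift_not_fpp R E (fun n => w n *: x n) (fun n => mu * w n) mu) => //.
- by move=> n; rewrite ler_peMr// ltW.
- move=> n; rewrite normrZ ger0_norm//.
  rewrite (le_trans (ler_wpM2l (w_ge0 _) (x_le _)))// mulrCA ler_wpM2l//; first exact: ltW.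
  rewrite /w -[n.+2%:R]natr1; have : 0 < n.+1%:R :> R by [].
  move: (n.+1%:R : R) => m m0; rewrite -subr_ge0.
  rewrite (_ : _ - _ = (m * (m + 1) ^+ 3)^-1); last first.
    by field; apply/andP; split; rewrite gt_eqF// ltr_wpDr.
  by rewrite invr_ge0 mulr_ge0 ?exprn_ge0 ?addr_ge0// ltW.
- move=> a N; have := x_lower (fun n => a n * w n) N.
  rewrite mulr_sumr; under eq_bigr do rewrite normrM (ger0_norm (w_ge0 _)).
  under [X in _ <= `|X| -> _]eq_bigr do rewrite -scalerA.
  by under [X in _ -> X <= _]eq_bigr do rewrite -mulrA (mulrC (w _)).
- move=> t st; under eq_fun do rewrite scalerA.
  apply: x_cvg; exists 2 => [n|N]; first by rewrite mulr_ge0// st.1.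
  rewrite (@le_trans _ _ (\sum_(0 <= n < N) t n * 2))//.
    apply: ler_sum => i _; rewrite ler_wpM2l ?st.1// /w -[leRHS]/(1 + 1) lerD2l.
    by rewrite invf_le1// ler1n.
  by rewrite -mulr_suml ler_piMl// simplex_sum_le1.
Qed.

(** Convergence of a series to a given sum, without completeness: remainders
    controlled by the tails of a convergent series of nonnegative reals. *)
Lemma cvg_series_dominated (R : realType) (E : normedModType R) (t : nat -> R)
    (u : nat -> E) (z : E) (r B : R) :
  (forall n, 0 <= t n) -> (forall N, series t N <= r) ->
  (forall N L, (forall M, \sum_(N <= n < M) t n <= L) -> `|z - series u N| <= B * L) ->
  cvgn (series u).
Proof.
move=> t0 tr H.
have nd : nondecreasing_seq (series t).
  by apply: nondecreasing_series => n _ _; exact: t0.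
have ct : cvgn (series t).
  by apply: nondecreasing_is_cvgn => //; exists r => _ [N _ <-].
apply/cvg_ex; exists z; apply/cvgrPdist_le => e e0.
have B1 : 0 < `|B| + 1 by rewrite ltr_wpDl.
have /cvgrPdist_le/(_ (e / (`|B| + 1))) := ct.
rewrite divr_gt0// => /(_ isT) Ht; near=> N.
have tN : `|limn (series t) - series t N| <= e / (`|B| + 1) by near: N.
apply: le_trans (H N `|limn (series t) - series t N| _) _; last first.
- rewrite (_ : e = (`|B| + 1) * (e / (`|B| + 1))); last by rewrite mulrC divfK// gt_eqF.
  apply: (@le_trans _ _ ((`|B| + 1) * `|limn (series t) - series t N|)); last by rewrite ler_pM2l.
  by rewrite ler_wpM2r// (le_trans (ler_norm _))// lerDl.
- move=> M; rewrite (le_trans _ (ler_norm _))//.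
  have [NM|MN] := leqP N M; last by rewrite big_geq ?subr_ge0 ?nondecreasing_cvgn_le// ltnW.
  rewrite lerBrDl (le_trans _ (nondecreasing_cvgn_le nd ct M))//.
  by rewrite /series /= [in leRHS](big_cat_nat _ NM).
Unshelve. all: by end_near. Qed.

Definition bounded_family (R : realType) (T : Type) (y : T -> R) :=
  exists r, forall i, `|y i| <= r.

Lemma bounded_familyD (R : realType) (T : Type) (a : R) (y z : T -> R) :
  bounded_family y -> bounded_family z -> bounded_family (fun i => a * y i + z i).
Proof.
move=> [r yr] [s zs]; exists (`|a| * r + s) => i.
by rewrite (le_trans (ler_normD _ _))// normrM lerD// ler_wpM2l.
Qed.

(** [Psi] is total, but constrained on bounded families only; with the supremum norm
    these form the space l_infty(T). *)
Definition linfty_embedding (R : realType) (T : Type) (V : normedModType R)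
    (Psi : (T -> R) -> V) :=
  [/\ forall (a : R) y z, bounded_family y -> bounded_family z ->
        Psi (fun i => a * y i + z i) = a *: Psi y + Psi z,
      forall y r, 0 <= r -> (forall i, `|y i| <= r) -> `|Psi y| <= r &
      forall y i, bounded_family y -> `|y i| <= `|Psi y|].

(** * Averages and martingales on the binary tree *)

Section tree_averages.
Variable R : realType.
Implicit Types (f g h : seq bool -> R) (w v : seq bool) (k j : nat).

(** The mean over the words of length [k]: a function on words is thought of as a
    function on the Cantor space through its values on the cylinders, and [avg k]
    is the integral at resolution [k]. *)
Fixpoint avg k f : R :=
  if k is k'.+1 then
    (avg k' (fun w => f (false :: w)) + avg k' (fun w => f (true :: w))) / 2
  else f [::].

Lemma le_avg k f g : (forall w, size w = k -> f w <= g w) -> avg k f <= avg k g.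
Proof.
elim: k f g => [|k IH] f g fg /=; first exact: fg.
by rewrite ler_wpM2r// lerD// IH// => w wk; apply: fg; rewrite /= wk.
Qed.

Lemma eq_avg k f g : (forall w, size w = k -> f w = g w) -> avg k f = avg k g.
Proof.
by move=> fg; apply/eqP; rewrite eq_le !le_avg// => w /fg ->.
Qed.

Lemma avg_linear k (a b : R) f g :
  avg k (fun w => a * f w + b * g w) = a * avg k f + b * avg k g.
Proof. by elim: k f g => [|k IH] f g //=; rewrite !IH; field. Qed.

Lemma avg_cst k (c : R) : avg k (fun=> c) = c.
Proof. by elim: k => //= k ->; field. Qed.

Lemma avgD k f g : avg k (fun w => f w + g w) = avg k f + avg k g.
Proof.
by have := avg_linear k 1 1 f g; under eq_avg do rewrite !mul1r; rewrite !mul1r.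
Qed.

Lemma avgZ k (a : R) f : avg k (fun w => a * f w) = a * avg k f.
Proof.
by elim: k f => [|k IH] f //=; rewrite !IH; field.
Qed.

Lemma avgB k f g : avg k (fun w => f w - g w) = avg k f - avg k g.
Proof.
rewrite -[- avg k g]mulN1r -avgZ -avgD.
by under [RHS]eq_avg do rewrite mulN1r.
Qed.

Lemma avg_ge0 k f : (forall w, size w = k -> 0 <= f w) -> 0 <= avg k f.
Proof. by move=> f0; rewrite -(avg_cst k 0); exact: le_avg. Qed.

Lemma avg_le0 k f : (forall w, 0 <= f w) -> avg k f <= 0 ->
  forall w, size w = k -> f w = 0.
Proof.
elim: k f => [|k IH] f f0 /= fk w; first by move=> /size0nil ->; apply/eqP; rewrite eq_le fk f0.
have a0 b : 0 <= avg k (fun w => f (b :: w)) by apply: avg_ge0.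
move: (a0 false) (a0 true) => a1 a2.
case: w => // b w [wk]; apply: (IH (fun w => f (b :: w))) => //.
by case: b; lra.
Qed.

Lemma avg_le_cst k f (c : R) : (forall w, size w = k -> f w <= c) -> avg k f <= c.
Proof. by move=> fc; rewrite -(avg_cst k c); exact: le_avg. Qed.

Lemma ler_norm_avg k f : `|avg k f| <= avg k (fun w => `|f w|).
Proof.
rewrite ler_norml -mulN1r -avgZ !le_avg//= => w _; first exact: ler_norm.
by rewrite mulN1r lerNl -normrN ler_norm.
Qed.

Lemma avg_cat k j f :
  avg (k + j) f = avg k (fun w => avg j (fun v => f (w ++ v))).
Proof. by elim: k f => [|k IH] f //=; rewrite !IH. Qed.

Lemma avg_cvg (T : Type) (F : set_system T) (FF : Filter F) k
    (f : T -> seq bool -> R) g :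
  (forall w, f x w @[x --> F] --> g w) -> avg k (f x) @[x --> F] --> avg k g.
Proof.
elim: k f g => [|k IH] f g fg /=; first exact: fg.
by apply: cvgM; [apply: cvgD; apply: IH => w; exact: fg|exact: cvg_cst].
Qed.

Definition martingale h :=
  forall w, h w = (h (rcons w false) + h (rcons w true)) / 2.

Lemma martingale_avg h k w : martingale h -> avg k (fun v => h (w ++ v)) = h w.
Proof.
move=> mh; elim: k w => [|k IH] w /=; first by rewrite cats0.
have E b : avg k (fun v => h (w ++ b :: v)) = h (rcons w b).
  by rewrite -IH; apply: eq_avg => v _; rewrite cat_rcons.
by rewrite !E -mh.
Qed.

Lemma martingaleD h g (a : R) :
  martingale h -> martingale g -> martingale (fun w => a * h w + g w).
Proof. by move=> mh mg w; rewrite mh mg; field. Qed.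

(** Conditional Jensen inequality: for convex [phi] the integral of [phi \o h]
    grows with the resolution. *)
Lemma le_avg_convex (phi : R -> R) h k j : martingale h ->
  (forall x y, phi ((x + y) / 2) <= (phi x + phi y) / 2) ->
  avg k (fun w => phi (h w)) <= avg (k + j) (fun w => phi (h w)).
Proof.
move=> mh cphi; rewrite avg_cat; apply: le_avg => w _.
elim: j w => [|j IH] w /=; first by rewrite cats0.
rewrite mh (le_trans (cphi _ _))// ler_wpM2r// lerD// (le_trans (IH _))//.
  by apply: le_avg => v _; rewrite cat_rcons.
by apply: le_avg => v _; rewrite cat_rcons.
Qed.

Lemma le_avg_sqr h k j : martingale h ->
  avg k (fun w => h w ^+ 2) <= avg (k + j) (fun w => h w ^+ 2).
Proof.
move=> mh; apply: (le_avg_convex (phi := fun x => x ^+ 2)) => // x y.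
rewrite -subr_ge0 (_ : _ - _ = ((x - y) / 2) ^+ 2) ?sqr_ge0//.
by field.
Qed.

(** Signs on the words, encoded by the list of the words that carry a plus sign, so
    that a level together with all the signs on it ranges over a countable type. *)
Definition sgnw (A : seq (seq bool)) w : R := if w \in A then 1 else -1.

Lemma norm_sgnw A w : `|sgnw A w| = 1.
Proof. by rewrite /sgnw; case: ifP; rewrite ?normrN normr1. Qed.

Definition words k : seq (seq bool) := [seq val t | t <- enum {: k.-tuple bool}].

Lemma mem_words k w : (w \in words k) = (size w == k).
Proof.
apply/mapP/eqP => [[t _ ->]|wk]; first by rewrite size_tuple.
by exists (Tuple (introT eqP wk)); rewrite // mem_enum.
Qed.

(** The pairings of [h] with the signs at level [i.1]: their supremum over the
    signs is the L1 norm of [h] at that level. *)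
Definition coord h (i : nat * seq (seq bool)) : R :=
  avg i.1 (fun w => sgnw i.2 w * h w).

Lemma coord_linear (a : R) h g i :
  coord (fun w => a * h w + g w) i = a * coord h i + coord g i.
Proof.
rewrite /coord -avgZ -avgD; apply: eq_avg => w _; by rewrite mulrDr mulrCA.
Qed.

Lemma norm_coord h i : `|coord h i| <= avg i.1 (fun w => `|h w|).
Proof.
apply: le_trans (ler_norm_avg _ _) _; apply: le_avg => w _.
by rewrite normrM norm_sgnw mul1r.
Qed.

Lemma coord_norming h k : exists A, coord h (k, A) = avg k (fun w => `|h w|).
Proof.
exists [seq w <- words k | 0 <= h w]; apply: eq_avg => w wk /=.
rewrite /sgnw mem_filter mem_words wk eqxx andbT; have [h0|h0] := leP 0 (h w).
  by rewrite mul1r ger0_norm.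
by rewrite mulN1r ltr0_norm.
Qed.

End tree_averages.

(** * Alspach's map *)

Section alspach.
Variable R : realType.
Implicit Types (f g h : seq bool -> R) (w v : seq bool) (k j : nat).

(** The functions on the Cantor space with values in [0, 1] and integral 1/2, given
    by their means on the cylinders. This is an order interval of L1 cut by a
    hyperplane, hence weakly compact. *)
Definition half_densities : set (seq bool -> R) :=
  [set h | (forall w, 0 <= h w <= 1) /\ martingale h /\ h [::] = 1 / 2].

Definition tent (x : R) : R := Num.min x (1 - x).

(** The mean over the cylinder [w] of [tent] of the density with means [h]: as [tent] is
    concave, [tent \o h] only gives averages that decrease to it. *)
Definition tent_mean h w : R :=
  limn (fun j => avg j (fun v => tent (h (w ++ v)))).

(** In terms of functions, [alspach] sends g to the function equal to min(2 g, 1) on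
    the first half of the Cantor space and to max(2 g - 1, 0) on the second half,
    each half being identified with the whole space: these are g + tent g and
    g - tent g. *)
Definition alspach h w : R :=
  if w is b :: w' then
    if b then h w' - tent_mean h w' else h w' + tent_mean h w'
  else 1 / 2.

Lemma tentP x : x <= 1 / 2 /\ tent x = x \/ 1 / 2 <= x /\ tent x = 1 - x.
Proof.
rewrite /tent; have [xh|/ltW xh] := leP x (1/2); [left|right]; split=> //.
  by rewrite min_l//; lra.
by rewrite min_r//; lra.
Qed.

Lemma tent_ge0 x : 0 <= x <= 1 -> 0 <= tent x.
Proof. by case: (tentP x) => -[] ? ->; lra. Qed.

Lemma tent_concave x y : (tent x + tent y) / 2 <= tent ((x + y) / 2).
Proof.
by case: (tentP x) (tentP y) (tentP ((x + y) / 2)) => -[? ->] [] [? ->] [] [? ->]; lra.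
Qed.

(** The maps x + tent x and x - tent x are both nondecreasing and add up to 2 x, so
    nothing cancels. *)
Lemma tent_isometry x y :
  (`|(x + tent x) - (y + tent y)| + `|(x - tent x) - (y - tent y)|) / 2 = `|x - y|.
Proof.
wlog xy : x y / x <= y.
  move=> H; have [/H//|/ltW/H] := leP x y.
  by rewrite (distrC (y + _)) (distrC (y - _)) (distrC y).
by case: (tentP x) (tentP y) => -[? ->] [] [? ->]; rewrite !ler0_norm; lra.
Qed.

Section half_density.
Variable h : seq bool -> R.
Hypothesis Mh : half_densities h.

Let h01 w : 0 <= h w <= 1. Proof. by have [] := Mh. Qed.
Let mh : martingale h. Proof. by have [_ []] := Mh. Qed.

Let tent_avg_noninc w :
  nonincreasing_seq (fun j => avg j (fun v => tent (h (w ++ v)))).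
Proof.
apply/nonincreasing_seqP => j.
have := @le_avg_convex R (fun x => -1 * tent x) (fun v => h (w ++ v)) j 1.
rewrite avgZ (avgZ (j + 1)) addn1 => H.
have {H} : -1 * avg j (fun v => tent (h (w ++ v))) <=
    -1 * avg j.+1 (fun v => tent (h (w ++ v))).
  apply: H => [v|x y]; first by rewrite mh !rcons_cat.
  by have := tent_concave x y; lra.
by rewrite !mulN1r lerN2.
Qed.

Let tent_avg_ge0 w j : 0 <= avg j (fun v => tent (h (w ++ v))).
Proof. by apply: avg_ge0 => v _; exact: tent_ge0. Qed.

Lemma tent_mean_cvg w :
  avg j (fun v => tent (h (w ++ v))) @[j --> \oo] --> tent_mean h w.
Proof.
apply: nonincreasing_is_cvgn; first exact: tent_avg_noninc.
by exists 0 => _ [j _ <-]; exact: tent_avg_ge0.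
Qed.

Lemma tent_mean_ge0 w : 0 <= tent_mean h w.
Proof.
apply: (cvgr_to_ge (@tent_mean_cvg w)); near=> j; exact: tent_avg_ge0.
Unshelve. all: by end_near. Qed.

Lemma tent_mean_le w : tent_mean h w <= tent (h w).
Proof.
have := nonincreasing_cvgn_ge (tent_avg_noninc w) (cvgP _ (@tent_mean_cvg w)) 0%N.
by rewrite /= cats0.
Qed.

Lemma martingale_tent_mean : martingale (tent_mean h).
Proof.
move=> w.
have H : avg j (fun v => tent (h (rcons w false ++ v))) +
   avg j (fun v => tent (h (rcons w true ++ v))) @[j --> \oo] -->
   tent_mean h (rcons w false) + tent_mean h (rcons w true).
  by apply: cvgD; exact: tent_mean_cvg.
have H2 := cvgM H (cvg_cst (2^-1 : R)).
have : avg j.+1 (fun v => tent (h (w ++ v))) @[j --> \oo] --> tent_mean h w.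
  by rewrite (cvg_shiftS (fun j => avg j (fun v => tent (h (w ++ v))))); exact: tent_mean_cvg.
under eq_fun => j.
  rewrite /= (eq_avg (g := fun v => tent (h (rcons w false ++ v)))); last first.
    by move=> v _; rewrite cat_rcons.
  rewrite [X in _ + X](eq_avg (g := fun v => tent (h (rcons w true ++ v)))); last first.
    by move=> v _; rewrite cat_rcons.
  over.
by move=> H1; exact: (cvg_unique (@Rhausdorff R) H1 (H2 _ _)).
Qed.

Lemma half_densities_alspach : half_densities (alspach h).
Proof.
split; [|split] => //.
- case=> [|b w] /=; first lra.
  have := tent_mean_ge0 w; have := tent_mean_le w; have := h01 w.
  rewrite /tent le_min => /andP[? ?] /andP[? ?] ?; case: b; lra.
- case=> [|b w] /=; first by have [_ [_ ->]] := Mh; lra.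
  by case: b; rewrite mh martingale_tent_mean; field.
Qed.

(** A fixed point h satisfies h(0w) = h(w) + D(w) and h(1w) = h(w) - D(w) for the
    nonnegative martingale D = tent_mean h. The mean of h^2 thus grows at each level
    by the mean of D^2, which is at least the square of the mean of D; being bounded
    by 1, it forces D = 0. Then h is the constant 1/2, for which D = 1/2. *)
Lemma alspach_no_fixpoint : ~ (forall w, alspach h w = h w).
Proof.
move=> fixh; pose d := tent_mean h [::].
have d0 : 0 <= d := tent_mean_ge0 [::].
have avgT k : avg k (tent_mean h) = d by exact: (martingale_avg k [::] martingale_tent_mean).
have energyS k : avg k.+1 (fun w => h w ^+ 2) =
    avg k (fun w => h w ^+ 2) + avg k (fun w => tent_mean h w ^+ 2).
  rewrite /= -avgD -avgD mulrC -avgZ; apply: eq_avg => w _.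
  by rewrite -(fixh (false :: w)) -(fixh (true :: w)) /=; field.
have energy_ge k : d ^+ 2 <= avg k (fun w => tent_mean h w ^+ 2).
  have : 0 <= avg k (fun w => (tent_mean h w ^+ 2 - (2 * d) * tent_mean h w) + d ^+ 2).
    apply: avg_ge0 => w _; rewrite (_ : _ + _ = (tent_mean h w - d) ^+ 2) ?sqr_ge0//.
    by ring.
  by rewrite avgD avgB avgZ avg_cst avgT; lra.
have energy k : k%:R * d ^+ 2 <= avg k (fun w => h w ^+ 2).
  elim: k => [|k IH]; first by rewrite mul0r sqr_ge0.
  by rewrite energyS -natr1 mulrDl mul1r lerD.
have d_eq0 : d = 0.
  apply/eqP; rewrite eq_le d0 andbT leNgt; apply/negP => d1.
  have [k _ /(_ k (leqnn k))] := nbhs_infty_gtr ((d ^+ 2)^-1).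
  rewrite /= ltNge => /negP; apply; rewrite -div1r ler_pdivlMr ?exprn_gt0//.
  rewrite (le_trans (energy k))// avg_le_cst// => w _.
  by have := h01 w; move: (h w) => x x01; nra.
have T0 w : tent_mean h w = 0.
  elim/last_ind: w => // w b IH.
  have := martingale_tent_mean w; rewrite IH.
  have := tent_mean_ge0 (rcons w false); have := tent_mean_ge0 (rcons w true).
  by case: b; lra.
have hh w : h w = 1 / 2.
  elim: w => [|b w IH]; first by have [_ [_ ->]] := Mh.
  by rewrite -fixh /= T0 IH; case: b; lra.
have := @tent_mean_cvg [::]; rewrite T0.
rewrite (_ : (fun j => _) = fun=> 1 / 2); last first.
  apply/funext => j; rewrite -[RHS](avg_cst j); apply: eq_avg => v _.
  by rewrite hh; case: (tentP (1 / 2)) => -[_ ->]; lra.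
move=> /cvg_lim; rewrite lim_cst// => /(_ (@Rhausdorff R)); lra.
Qed.

End half_density.

(** Pointwise, [tent_isometry] says that the map preserves the L1 distance; since
    [tent_mean] is a limit of averages, the inequality at each level is obtained in
    the limit from the averages at deeper levels. *)
Lemma alspach_nonexpansive h g (r : R) : half_densities h -> half_densities g ->
  (forall k, avg k (fun w => `|h w - g w|) <= r) ->
  forall k, avg k (fun w => `|alspach h w - alspach g w|) <= r.
Proof.
move=> Mh Mg hg [|k].
  by rewrite /= subrr normr0 (le_trans _ (hg 0%N))// avg_ge0.
rewrite /= -avgD mulrC -avgZ.
pose a s f w j := avg j (fun v => f (w ++ v) + s * tent (f (w ++ v))).
have a_cvg s f w : half_densities f -> a s f w j @[j --> \oo] --> f w + s * tent_mean f w.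
  move=> Mf; have [_ [mf _]] := Mf.
  rewrite /a; under eq_fun do rewrite avgD avgZ martingale_avg//.
  by apply: cvgD; [exact: cvg_cst|apply: cvgM; [exact: cvg_cst|exact: tent_mean_cvg]].
have H : avg k (fun w => 2^-1 * (`|a 1 h w j - a 1 g w j| + `|a (-1) h w j - a (-1) g w j|))
   @[j --> \oo] --> avg k (fun w => 2^-1 *
     (`|(h w + 1 * tent_mean h w) - (g w + 1 * tent_mean g w)| +
      `|(h w + -1 * tent_mean h w) - (g w + -1 * tent_mean g w)|)).
  apply: avg_cvg => w; apply: cvgM; first exact: cvg_cst.
  by apply: cvgD; apply: cvg_norm; apply: cvgB; exact: a_cvg.
have := cvgr_to_le H; under eq_avg do rewrite !mul1r !mulN1r; apply.
near=> j; apply: le_trans (hg (k + j)%N); rewrite avg_cat; apply: le_avg => w _.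
rewrite /a -!avgB ler_pdivrMl//.
rewrite (le_trans (lerD (ler_norm_avg _ _) (ler_norm_avg _ _)))// -avgD -avgZ le_avg// => v _.
rewrite -(tent_isometry (h _)) [leRHS]mulrC divfK// !mul1r !mulN1r.
exact: lexx.
Unshelve. all: by end_near. Qed.

End alspach.

Arguments half_densities {R}.

(** * Weak continuity through the Banach-Saks argument *)

Section banach_saks.
Variables (R : realType) (L : (seq bool -> R) -> R) (C : R).
Implicit Types (f g h : seq bool -> R) (w v : seq bool) (k j : nat).

Lemma half_densities_bounded h : half_densities h -> bounded_family h.
Proof. by move=> [h01 _]; exists 1 => w; have /andP[h0 h1] := h01 w; rewrite ger0_norm. Qed.

Hypothesis L_linear : forall a h g, bounded_family h -> bounded_family g ->
  L (fun w => a * h w + g w) = a * L h + L g.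
Hypothesis L_le : forall h r, bounded_family h ->
  (forall k, avg k (fun w => `|h w|) <= r) -> `|L h| <= C * r.

(** [Q] stands for the elements of [half_densities] at which [L] stays away from its
    value at [h0], under the assumption that [h0] is a limit point of them for the
    topology of pointwise convergence. *)
Variables (h0 : seq bool -> R) (Q : set (seq bool -> R)) (eps : R).
Hypothesis Mh0 : half_densities h0.
Hypothesis eps_gt0 : 0 < eps.
Hypothesis Q_half : Q `<=` half_densities.
Hypothesis Q_close : forall k f (eta : R), 0 < eta ->
  exists2 g, Q g & `|avg k (fun w => f w * (-1 * h0 w + g w))| <= eta.
Hypothesis Q_far : forall g, Q g -> eps <= `|L (fun w => -1 * h0 w + g w)|.

Let diffP g : Q g -> let d := fun w => -1 * h0 w + g w in
  [/\ martingale d, bounded_family d & forall w, d w ^+ 2 <= 1].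
Proof.
move=> /Q_half Mg; split.
- by apply: martingaleD; [have [_ []] := Mh0|have [_ []] := Mg].
- by apply: bounded_familyD; exact: half_densities_bounded.
- move=> w; have [/(_ w) + _] := Mh0; have [/(_ w) + _] := Mg; nra.
Qed.

(** By orthogonality of the increments of a martingale, the gain of energy is the
    squared L2 distance from the conditional expectation at level [k]. *)
Let energy_stable h (r : R) : martingale h ->
  (forall k, avg k (fun w => h w ^+ 2) <= r) ->
  exists k, forall j, avg (k + j) (fun w => h w ^+ 2) <= avg k (fun w => h w ^+ 2) + 1 / 4.
Proof.
move=> mh hr; pose e k := avg k (fun w => h w ^+ 2).
have e_nd : nondecreasing_seq e.
  by apply/nondecreasing_seqP => k; rewrite /e -[k.+1]addn1; exact: le_avg_sqr.
have e_cvg : cvgn e.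
  by apply: nondecreasing_is_cvgn => //; exists r => _ [k _ <-]; exact: hr.
have /cvgrPdist_lt/(_ (1/4)) := e_cvg.
move=> [|k _ /(_ k (leqnn k)) /= ke]; first lra.
exists k => j; apply: (@le_trans _ _ (limn e)).
  exact: (nondecreasing_cvgn_le e_nd e_cvg (k + j)).
by move: ke => /(le_lt_trans (ler_norm _)); rewrite -/(e k); lra.
Qed.

(** Each new difference, with the sign that makes [L] large, is chosen almost
    orthogonal to the sum [h] of the previous ones: pointwise convergence makes it
    almost orthogonal to the conditional expectation of [h] at a level [k] beyond
    which [h] hardly changes. Its square contributes at most 1, the cross term at
    most 2. *)
Let almost_orthogonal_sum (m : nat) : exists h, [/\ martingale h, bounded_family h,
  forall k, avg k (fun w => h w ^+ 2) <= 3 * m%:R & m%:R * eps <= L h].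
Proof.
elim: m => [|m [h [mh bh hm Lh]]].
  exists (fun=> 0); split.
  - by move=> w; rewrite addr0 mul0r.
  - by exists 0 => w; rewrite normr0.
  - by move=> k; rewrite expr0n/= avg_cst mulr0.
  - have b0 : bounded_family (fun _ : seq bool => 0 : R) by exists 0 => w; rewrite normr0.
    have := L_le (r := 0) b0; rewrite mulr0 normr_le0 mul0r => /(_ _)/eqP -> // k.
    by rewrite normr0 avg_cst.
have [k hk] := energy_stable mh hm.
have [g Qg gk] := Q_close k h (eta := 1 / 4) ltac:(lra).
pose d := fun w => -1 * h0 w + g w.
have [md bd d1] : [/\ martingale d, bounded_family d & forall w, d w ^+ 2 <= 1] := diffP Qg.
have Ld : eps <= `|L d| := Q_far Qg.
have {}gk : `|avg k (fun w => h w * d w)| <= 1 / 4 := gk.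
pose s : R := Num.sg (L d).
have s2 : s ^+ 2 = 1.
  rewrite sqr_sg; case: eqP => // Ld0.
  by move: Ld; rewrite Ld0 normr0 leNgt eps_gt0.
have mG := martingaleD s md mh; have bG := bounded_familyD s bd bh.
exists (fun w => s * d w + h w); split => //; last first.
  rewrite L_linear// -natr1 mulrDl mul1r addrC lerD//.
  by rewrite (le_trans Ld)// normrEsg.
suff tail j : avg (k + j) (fun w => (s * d w + h w) ^+ 2) <= 3 * m.+1%:R.
  by move=> i; apply: le_trans (le_avg_sqr i k mG) _; rewrite addnC tail.
have orth : avg k (fun w => avg j (fun v => s * (h w * d (w ++ v)))) <= 1 / 4.
  under eq_avg do rewrite avgZ avgZ martingale_avg//.
  rewrite avgZ (le_trans (ler_norm _))// normrM normr_sg.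
  by rewrite (le_trans _ gk)// ler_piMl// lern1 leq_b1.
have spread : avg k (fun w => avg j (fun v => (h (w ++ v) - h w) ^+ 2)) <= 1 / 4.
  rewrite (eq_avg (g := fun w => avg j (fun v => h (w ++ v) ^+ 2) - h w ^+ 2)); last first.
    move=> w _.
    rewrite (eq_avg (g := fun v => h (w ++ v) ^+ 2 - 2 * h w * h (w ++ v) + h w ^+ 2)); last first.
      by move=> v _; ring.
    by rewrite avgD avgB avgZ martingale_avg// avg_cst; ring.
  by rewrite avgB -(avg_cat k j (fun w => h w ^+ 2)) lerBlDl.
(* 2 (h - h_k) s d <= 4 (h - h_k)^2 + d^2 / 4 for the part of the cross term that is
   not seen at level [k]; here h_k is [h] at level [k]. *)
apply: (@le_trans _ _ (avg (k + j) (fun w => h w ^+ 2) +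
   2 * avg k (fun w => avg j (fun v => s * (h w * d (w ++ v)))) +
   4 * avg k (fun w => avg j (fun v => (h (w ++ v) - h w) ^+ 2)) + 5 / 4)).
  rewrite !(avg_cat k j) -!avgZ -!avgD -[X in _ <= _ + X](avg_cst k) -avgD; apply: le_avg => w _.
  rewrite -!avgZ -!avgD -[X in _ <= _ + X](avg_cst j) -avgD; apply: le_avg => v _.
  have := d1 (w ++ v); move: (d _) (h (w ++ v)) (h w) => x y z x1.
  rewrite -subr_ge0 (_ : _ - _ = (s * x / 2 - 2 * (y - z)) ^+ 2 +
    (5 / 4 - s ^+ 2 * x ^+ 2 - s ^+ 2 * x ^+ 2 / 4)).
    by rewrite addr_ge0 ?sqr_ge0// s2; lra.
  by field.
by have := hm (k + j)%N; rewrite -natr1; lra.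
Qed.

(** A sum of m almost orthogonal differences has L2 norm, hence L1 norm, at most
    sqrt(3 m), whereas [L] is at least m * eps there. With m = 3 n^2 the root is
    3 n, and n > C / eps gives a contradiction. *)
Lemma banach_saks : False.
Proof.
have [n _ /(_ n (leqnn n)) /= nC] := nbhs_infty_gtr (`|C| / eps + 1).
have n0 : 0 < n%:R :> R by rewrite (le_lt_trans _ nC)// addr_ge0// divr_ge0// ltW.
have [h [mh bh hm Lh]] := almost_orthogonal_sum (3 * n ^ 2).
have h1 k : avg k (fun w => `|h w|) <= 3 * n%:R.
  apply: (@le_trans _ _ (avg k (fun w => (6 * n%:R)^-1 * h w ^+ 2 + 3 * n%:R / 2))).
    apply: le_avg => w _; rewrite -[h w ^+ 2]real_normK ?num_real//.
    move: `|h w| => x; rewrite -subr_ge0.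
    rewrite (_ : _ - _ = (x - 3 * n%:R) ^+ 2 / (6 * n%:R)); last by field; rewrite gt_eqF.
    by rewrite divr_ge0 ?sqr_ge0// mulr_ge0// ltW.
  rewrite avgD avgZ avg_cst.
  apply: (@le_trans _ _ ((6 * n%:R)^-1 * (3 * (3 * n ^ 2)%:R) + 3 * n%:R / 2)).
    by rewrite lerD2r ler_wpM2l// invr_ge0 mulr_ge0// ltW.
  by rewrite natrM natrX le_eqVlt; apply/orP; left; apply/eqP; field; rewrite gt_eqF.
have : (3 * n ^ 2)%:R * eps <= `|C| * (3 * n%:R).
  apply: (le_trans Lh); apply: (le_trans (ler_norm _)); apply: (le_trans (L_le bh h1)).
  by rewrite ler_wpM2r ?ler_norm// mulr_ge0// ltW.
rewrite natrM natrX leNgt => /negP; apply.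
rewrite (_ : `|C| * _ = 3 * (n%:R * `|C|)); last by ring.
rewrite (_ : _ * eps = 3 * (n%:R * (n%:R * eps))); last by ring.
rewrite ltr_pM2l// ltr_pM2l// -ltr_pdivrMr//.
by rewrite (le_lt_trans _ nC)// lerDl.
Qed.

End banach_saks.

(** * Failure of the weak fixed point property in spaces containing l_infty *)

Lemma half_densities_cst (R : realType) : half_densities (fun _ : seq bool => 1 / 2 : R).
Proof.
split; [|split] => //.
  by move=> w; apply/andP; split; lra.
by move=> w /=; field.
Qed.

Section weak_fpp.
Variables (R : realType) (V : normedModType R).
Variable Psi : (nat * seq (seq bool) -> R) -> V.
Hypothesis PsiP : linfty_embedding Psi.
Implicit Types (f g h : seq bool -> R) (w v : seq bool) (k j : nat).

Local Notation trees := {ptws seq bool -> R}.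

(** L1 of the Cantor space embeds isometrically in l_infty, hence in [V]. *)
Let emb (h : trees) : V := Psi (coord h).

Let bounded_coord h : bounded_family h -> bounded_family (coord h).
Proof.
move=> [r hr]; exists r => i; rewrite (le_trans (norm_coord _ _))//.
by apply: avg_le_cst => w _.
Qed.

Let emb_linear (a : R) h g : bounded_family h -> bounded_family g ->
  emb (fun w => a * h w + g w) = a *: emb h + emb g.
Proof.
move=> bh bg; have [Psi_lin _ _] := PsiP.
rewrite /emb -Psi_lin; [|exact: bounded_coord..].
by congr Psi; apply/funext => i; exact: coord_linear.
Qed.

Let emb_le h r : (forall k, avg k (fun w => `|h w|) <= r) -> `|emb h| <= r.
Proof.
move=> hr; have [_ Psi_le _] := PsiP.
apply: Psi_le => [|i]; first exact: le_trans (normr_ge0 _) (hr 0%N).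
exact: le_trans (norm_coord _ _) (hr _).
Qed.

Let emb_ge h k : bounded_family h -> avg k (fun w => `|h w|) <= `|emb h|.
Proof.
move=> bh; have [_ _ Psi_ge] := PsiP; have [A <-] := coord_norming h k.
by rewrite (le_trans (ler_norm _))// Psi_ge//; exact: bounded_coord.
Qed.

Let embB h g : bounded_family h -> bounded_family g ->
  emb h - emb g = emb (fun w => -1 * g w + h w).
Proof. by move=> bh bg; rewrite emb_linear// scaleN1r addrC. Qed.

Let normBE h g : (fun w => `| -1 * g w + h w|) = (fun w => `|h w - g w|).
Proof. by apply/funext => w; rewrite mulN1r addrC. Qed.

Let proj_cvg (h : trees) w : g w @[g --> nbhs (h : trees)] --> h w.
Proof. exact: (@proj_continuous _ (fun=> R) w h). Qed.

Let half_densities_compact : compact (half_densities : set trees).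
Proof.
have box : compact [set h : trees | forall w, `[0, 1]%classic (h w)].
  by apply: (@tychonoff _ (fun=> R) (fun=> `[0, 1]%classic)) => w; exact: segment_compact.
apply: (subclosed_compact _ box); last first.
  by move=> h [h01 _] w /=; rewrite in_itv/=; exact: h01.
move=> h /= clh.
have FF : ProperFilter (within half_densities (nbhs (h : trees))).
  exact: (@within_nbhs_proper trees half_densities h clh).
have hw w : g w @[g --> within half_densities (nbhs (h : trees))] --> h w.
  exact: (@cvg_within_filter _ _ _ _ (@nbhs_filter trees h) _ _ (@proj_cvg h w)).
have nearM : \forall g \near within half_densities (nbhs (h : trees)), half_densities g.
  exact: (withinT half_densities (@nbhs_filter trees h)).
split; [|split].
- move=> w; apply/andP; split.
    apply: (cvgr_to_ge (hw w)); near=> g.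
    by have [/(_ w)/andP[]] : half_densities g by near: g.
  apply: (cvgr_to_le (hw w)); near=> g.
  by have [/(_ w)/andP[]] : half_densities g by near: g.
- move=> w.
  have H : (g (rcons w false) + g (rcons w true)) / 2
     @[g --> within half_densities (nbhs (h : trees))] -->
     (h (rcons w false) + h (rcons w true)) / 2.
    by apply: cvgM; [apply: cvgD; exact: hw|exact: cvg_cst].
  apply: (cvg_unique (@Rhausdorff R) (hw w)).
  apply: cvg_trans H; apply: near_eq_cvg; near=> g.
  by have [_ [/(_ w) ->]] : half_densities g by near: g.
- apply: (cvg_unique (@Rhausdorff R) (hw [::])).
  apply: cvg_near_cst; near=> g.
  by have [_ []] : half_densities g by near: g.
Unshelve. all: by end_near. Qed.

(** The weak continuity of [emb] on [half_densities]: any neighborhood of [h] on which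
    [F \o emb] fails to be close to its value at [h] feeds [banach_saks]. *)
Let functional_continuous (F : dual V) (h : trees) : half_densities h ->
  F (emb g) @[g --> within half_densities (nbhs (h : trees))] --> F (emb h).
Proof.
have FN : Filter (nbhs (h : trees)) := @nbhs_filter trees h.
have FW : Filter (within half_densities (nbhs (h : trees))) by exact: within_filter.
move=> Mh; apply/cvgrPdist_lt => e e0; apply: contrapT => nF.
have [Flin _] := dual_predP _ (dual_valP F).
pose Q : set trees := [set g | half_densities g /\ e <= `|F (emb h) - F (emb g)|].
have FB g : half_densities g -> F (emb (fun w => -1 * h w + g w)) = F (emb g) - F (emb h).
  move=> Mg; rewrite emb_linear; [|exact: half_densities_bounded..].
  by rewrite Flin addrC scaleN1r.
apply: (@banach_saks R (fun h => F (emb h)) (dual_norm F) _ _ h Q e) => //.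
- by move=> a f g bf bg; rewrite emb_linear// Flin.
- move=> f r bf fr; rewrite (le_trans (dual_norm_ge _ _))//.
  by rewrite ler_wpM2l ?dual_norm_ge0// emb_le.
- by move=> g [].
- move=> k f eta eta0; apply: contrapT => noQ; apply: nF.
  have : avg k (fun w => f w * (-1 * h w + g w)) @[g --> nbhs (h : trees)] -->
      avg k (fun w => f w * (-1 * h w + h w)).
    apply: avg_cvg => w; apply: cvgM; first exact: cvg_cst.
    by apply: cvgD; [exact: cvg_cst|exact: proj_cvg].
  rewrite [X in _ --> X](_ : _ = 0); last first.
    by rewrite -(avg_cst k 0); apply: eq_avg => w _; rewrite mulN1r addNr mulr0.
  move=> /cvgr0Pnorm_le/(_ _ eta0); rewrite /within /=; apply: filterS => g gk Mg.
  rewrite ltNge; apply/negP => eg; apply: noQ; exists g => //.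
- by move=> g [Mg eg]; rewrite FB// distrC.
Qed.

Let K : set V := emb @` half_densities.

Let K_weakly_compact : weakly_compact K.
Proof.
rewrite /weakly_compact /K.
apply: (@continuous_compact trees (weak_topology V) emb) => //.
apply: continuous_comp_initial => h; apply/pointwise_cvgP => F.
have H : continuous ((fun g => F (emb g)) : subspace (half_densities : set trees) -> R).
  by apply/subspace_continuousP => g Mg; exact: functional_continuous.
exact: H.
Qed.

Let K_convex : convex_set (K : set (convex_lmodType V)).
Proof.
move=> x y l; rewrite !inE => -[h Mh <-] [g Mg <-].
have -> : conv l (emb h : convex_lmodType V) (emb g) =
  l%:num *: emb h + (1 - l%:num) *: emb g by [].
have bg := half_densities_bounded Mg; have bh := half_densities_bounded Mh.
have l01 : 0 <= l%:num <= 1 by rewrite ge0 le1.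
exists (fun w => l%:num * (-1 * g w + h w) + g w); last first.
  rewrite !emb_linear//; last exact: bounded_familyD.
  by rewrite scaleN1r scalerDr scalerN scalerBl scale1r [RHS]addrCA [LHS]addrC (addrC (- _)).
have [h01 [mh h0]] := Mh; have [g01 [mg g0]] := Mg; split; [|split].
- by move=> w; move: (h01 w) (g01 w); nra.
- by apply: martingaleD => //; exact: martingaleD.
- by rewrite h0 g0; lra.
Qed.

(** The image of [half_densities] is weakly compact, as the continuous image of a
    closed subset of the compact product of the intervals [0, 1], and carries
    Alspach's map. *)
Lemma linfty_not_weak_fpp : ~ weak_fixed_point_property V.
Proof.
have /choice[dens densP] x : exists h, K x -> half_densities h /\ emb h = x.
  have [[h Mh <-]|nK] := pselect (K x); first by exists h.
  by exists (fun=> 0).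
have embB_half h g : half_densities h -> half_densities g ->
    emb h - emb g = emb (fun w => -1 * g w + h w).
  by move=> Mh Mg; rewrite embB//; exact: half_densities_bounded.
have diff_bounded h g : half_densities h -> half_densities g ->
    bounded_family (fun w => -1 * g w + h w).
  by move=> Mh Mg; apply: bounded_familyD; exact: half_densities_bounded.
move=> /(_ K _ K_weakly_compact K_convex (fun x => emb (alspach (dens x)))) [|x Kx|x y Kx Ky|x Kx].
- by exists (emb (fun=> 1 / 2)), (fun=> 1 / 2) => //; exact: half_densities_cst.
- exists (alspach (dens x)) => //.
  by apply: half_densities_alspach; have [] := densP x Kx.
- have [Mh hx] := densP x Kx; have [Mg gy] := densP y Ky.
  rewrite embB_half; [|exact: half_densities_alspach..].
  apply: emb_le => k; rewrite normBE.
  apply: alspach_nonexpansive => // {}k; rewrite -normBE -{2}hx -{2}gy embB_half//.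
  by apply: emb_ge; exact: diff_bounded.
- have [Mh hx] := densP x Kx; rewrite -{2}hx => /eqP; rewrite -subr_eq0 => /eqP fix0.
  have Ma := half_densities_alspach Mh.
  apply: (alspach_no_fixpoint Mh) => w; apply/eqP; rewrite -subr_eq0 -normr_eq0.
  apply/eqP; apply: (avg_le0 (k := size w) (f := fun w => `|alspach (dens x) w - dens x w|)) => //.
  rewrite -normBE (le_trans (emb_ge _ _))//; first exact: diff_bounded.
  by rewrite -embB_half// fix0 normr0.
Qed.

End weak_fpp.

(** * Renormings of spaces containing l_infty *)

Section sign_patterns.
Variable R : realType.
Implicit Types (s : seq (nat -> bool)) (c : (nat -> bool) -> R).

(** An independent family of signs: the branches of the binary tree being separated
    at some level, any choice of signs on finitely many branches is realized by one
    index. This embeds l1 over the uncountable set of branches in l_infty. *)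
Definition pattern (gamma : nat -> bool) (i : nat * seq (seq bool)) : R :=
  sgnw R i.2 (mkseq gamma i.1).

Definition comb s c i : R := \sum_(gamma <- s) c gamma * pattern gamma i.

Definition mass s c : R := \sum_(gamma <- s) `|c gamma|.

Lemma separating_level s : exists k, {in s &, injective (fun gamma => mkseq gamma k)}.
Proof.
have /choice[f fP] (p : (nat -> bool) * (nat -> bool)) :
    exists n, p.1 <> p.2 -> p.1 n <> p.2 n.
  have [[n pn]|H] := pselect (exists n, p.1 n <> p.2 n); first by exists n.
  exists 0%N => p12; exfalso; apply: p12; apply/funext => n.
  by apply: contrapT => pn; apply: H; exists n.
exists (\max_(x <- s) \max_(y <- s) f (x, y)).+1 => x y xs ys xy.
apply: contrapT => /(fP (x, y)) /=; apply.
have fk : (f (x, y) < (\max_(x <- s) \max_(y <- s) f (x, y)).+1)%N.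
  rewrite ltnS (leq_trans _ (leq_bigmax_seq _ xs isT))//.
  exact: (leq_bigmax_seq (F := fun y => f (x, y)) _ ys isT).
by rewrite -(nth_mkseq false x fk) xy nth_mkseq.
Qed.

Lemma norm_comb s c i : `|comb s c i| <= mass s c.
Proof.
rewrite (le_trans (ler_norm_sum _ _ _))// ler_sum// => gamma _.
by rewrite normrM norm_sgnw mulr1.
Qed.

Lemma comb_norming s c : exists i, comb s c i = mass s c.
Proof.
have [k kP] := separating_level s.
exists (k, [seq mkseq gamma k | gamma <- s & 0 <= c gamma]).
apply: eq_big_seq => gamma gs; rewrite /pattern /sgnw /=.
case: ifP => [/mapP[gamma' + gg]|/negP H].
  rewrite mem_filter => /andP[c0 g's]; rewrite (kP _ _ gs g's gg) mulr1 ger0_norm//.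
have [c0|c0] := leP 0 (c gamma); last by rewrite mulrN1 ltr0_norm.
by exfalso; apply: H; apply/mapP; exists gamma => //; rewrite mem_filter c0.
Qed.

Lemma combZ s c (a : R) i : comb s (fun gamma => a * c gamma) i = a * comb s c i.
Proof. by rewrite /comb mulr_sumr; apply: eq_bigr => gamma _; rewrite mulrA. Qed.

Lemma massZ s c (a : R) : mass s (fun gamma => a * c gamma) = `|a| * mass s c.
Proof. by rewrite /mass mulr_sumr; apply: eq_bigr => gamma _; rewrite normrM. Qed.

Lemma comb_bounded s c : bounded_family (comb s c).
Proof. by exists (mass s c) => i; exact: norm_comb. Qed.

(** Cantor's diagonal argument. *)
Lemma branch_notin_countable (A : set (nat -> bool)) : countable A ->
  exists gamma, ~ A gamma.
Proof.
move=> /countable_injP[f f_inj].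
have /choice[g gP] n : exists gamma, forall gamma', A gamma' -> f gamma' = n -> gamma = gamma'.
  have [[gamma [Ag fg]]|H] := pselect (exists gamma, A gamma /\ f gamma = n).
    exists gamma => gamma' Ag' fg'; apply: f_inj; rewrite ?inE//.
    by rewrite fg fg'.
  by exists (fun=> true) => gamma Ag fg; exfalso; apply: H; exists gamma.
exists (fun n => ~~ g n n) => Ad.
have /(congr1 (@^~ (f (fun n => ~~ g n n)))) := gP _ _ Ad erefl.
by case: (g _ _).
Qed.

End sign_patterns.

Section renorming.
Variables (R : realType) (V : normedModType R).
Variable Psi : (nat * seq (seq bool) -> R) -> V.
Hypothesis PsiP : linfty_embedding Psi.
Variable N : equivalent_norm V.
Implicit Types (s : seq (nat -> bool)) (c : (nat -> bool) -> R)
  (A : set (nat -> bool)).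

Let nu s c := eqnorm N (Psi (comb s c)).

Let lo : {lC : R * R | [/\ 0 < lC.1, 0 < lC.2 &
  forall x, lC.1 * `|x| <= eqnorm N x <= lC.2 * `|x|]}.
Proof.
by apply: cid; have [l [C H]] := eqnorm_equiv N; exists (l, C).
Qed.

Let l := (sval lo).1.
Let C := (sval lo).2.
Let l_gt0 : 0 < l. Proof. by have [] := svalP lo. Qed.
Let C_gt0 : 0 < C. Proof. by have [] := svalP lo. Qed.
Let eqnormP x : l * `|x| <= eqnorm N x <= C * `|x|.
Proof. by have [_ _] := svalP lo; apply. Qed.

Let mass_ge0 s c : 0 <= mass s c. Proof. exact: sumr_ge0. Qed.

Let nu_ge s c : l * mass s c <= nu s c.
Proof.
have [i <-] := comb_norming s c; have [_ _ Psi_ge] := PsiP.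
have /andP[+ _] := eqnormP (Psi (comb s c)); apply: le_trans.
rewrite ler_pM2l// (le_trans (ler_norm _))// Psi_ge//; exact: comb_bounded.
Qed.

Let nu_le s c : nu s c <= C * mass s c.
Proof.
have [_ Psi_le _] := PsiP.
have /andP[_] := eqnormP (Psi (comb s c)); move=> /le_trans; apply.
by rewrite ler_pM2l// Psi_le// => i; exact: norm_comb.
Qed.

Let Psi0 : Psi (fun=> 0) = 0.
Proof.
have [_ Psi_le _] := PsiP; apply/eqP; rewrite -normr_le0.
by apply: Psi_le => // i; rewrite normr0.
Qed.

Let PsiZ (a : R) y : bounded_family y -> Psi (fun i => a * y i) = a *: Psi y.
Proof.
have [Psi_lin _ _] := PsiP => by_.
have := Psi_lin a y (fun=> 0) by_; rewrite Psi0 addr0 => <-; last by exists 0 => i; rewrite normr0.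
by congr Psi; apply/funext => i; rewrite addr0.
Qed.

Let nuZ s c (a : R) : nu s (fun gamma => a * c gamma) = `|a| * nu s c.
Proof.
rewrite /nu -eqnormZ -PsiZ; last exact: comb_bounded.
by congr (eqnorm N (Psi _)); apply/funext => i; exact: combZ.
Qed.

(** The vectors of the unit sphere of l1 with finite support outside [A]. *)
Definition unit_block A s c := [/\ uniq s, forall gamma, gamma \in s -> ~ A gamma &
  mass s c = 1].

Definition block_norms A := [set r | exists s c, unit_block A s c /\ nu s c = r].

Let block_norms_nonempty A : countable A -> block_norms A !=set0.
Proof.
move=> /branch_notin_countable[gamma Ag]; exists (nu [:: gamma] (fun=> 1)).
exists [:: gamma], (fun=> 1); split => //; split => //.
  by move=> g; rewrite inE => /eqP ->.
by rewrite /mass big_seq1 normr1.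
Qed.

Let block_norms_bound A r : block_norms A r -> l <= r <= C.
Proof.
move=> [s [c [[_ _ m1] <-]]].
by have := nu_ge s c; have := nu_le s c; rewrite m1 !mulr1 => -> ->.
Qed.

Let inf_nu A := inf (block_norms A).

Let inf_nu_le A r : block_norms A r -> inf_nu A <= r.
Proof.
move=> Ar; apply: ge_inf => //; exists l => s /block_norms_bound/andP[]//.
Qed.

Let inf_nu_bound A : countable A -> l <= inf_nu A <= C.
Proof.
move=> cA; have [r Ar] := block_norms_nonempty cA; apply/andP; split.
  by apply: lb_le_inf; [exists r|move=> s /block_norms_bound/andP[]].
by rewrite (le_trans (inf_nu_le Ar))//; have /andP[] := block_norms_bound Ar.
Qed.

Let le_inf_nu A B : A `<=` B -> countable B -> inf_nu A <= inf_nu B.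
Proof.
move=> AB cB; apply: lb_le_inf; first exact: block_norms_nonempty.
move=> r [s [c [[us sB m1] <-]]]; apply: inf_nu_le; exists s, c; split => //; split => //.
by move=> gamma /sB + /AB.
Qed.

(** [inf_nu A] increases with [A] and is bounded; as a countable union of countable
    sets is countable, its supremum over the countable sets is attained, and past
    such a set it is constant. Uncountability enters through the existence of blocks
    outside every countable set. *)
Let stable : exists A0, countable A0 /\
  forall A, countable A -> A0 `<=` A -> inf_nu A = inf_nu A0.
Proof.
pose S := [set r | exists A, countable A /\ inf_nu A = r].
have supS : has_sup S.
  split; first by exists (inf_nu set0), set0.
  by exists C => r [A [cA <-]]; have /andP[] := inf_nu_bound cA.
have /choice[F FP] n : exists A, countable A /\ sup S - n.+1%:R^-1 < inf_nu A.
  have [|r [A [cA <-]] Ar] := sup_adherent (eps := n.+1%:R^-1) _ supS; first by rewrite invr_gt0.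
  by exists A.
have cU : countable (\bigcup_n F n).
  by apply: bigcup_countable => // n _; have [] := FP n.
exists (\bigcup_n F n); split => // A cA UA.
apply/eqP; rewrite eq_le (le_inf_nu UA cA) andbT.
rewrite (@le_trans _ _ (sup S))//.
  by apply: ub_le_sup; [exact: supS.2|exists A].
rewrite leNgt; apply/negP => US.
rewrite -subr_gt0 in US.
have [n _ /(_ n (leqnn n)) nP] := near_infty_natSinv_lt (PosNum US).
have {}nP : n.+1%:R^-1 < sup S - inf_nu (\bigcup_n F n) := nP.
have [_ Fn] := FP n; have FU : inf_nu (F n) <= inf_nu (\bigcup_n F n).
  by apply: le_inf_nu => //; exact: bigcup_sup.
have := lt_le_trans Fn FU; rewrite ltrBlDr -ltrBlDl => /(lt_trans nP).
by rewrite ltxx.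
Qed.

(** Outside [A0] the new norm is at least [mu] times the l1 norm, and almost equality
    holds at some block outside any larger countable set. Disjoint blocks with this
    property span an asymptotically isometric copy of l1. *)
Section blocks.
Variable A0 : set (nat -> bool).
Hypothesis A0_countable : countable A0.
Hypothesis A0_stable : forall A, countable A -> A0 `<=` A -> inf_nu A = inf_nu A0.

Let mu := inf_nu A0.

Let mu_gt0 : 0 < mu.
Proof. by have /andP[+ _] := inf_nu_bound A0_countable; exact: lt_le_trans. Qed.

Let nu_ge_mu s c : uniq s -> (forall gamma, gamma \in s -> ~ A0 gamma) ->
  mu * mass s c <= nu s c.
Proof.
move=> us sA; have := mass_ge0 s c; rewrite le_eqVlt => /orP[/eqP m0|m0].
  by rewrite -m0 mulr0 (le_trans _ (nu_ge s c))// -m0 mulr0.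
rewrite -ler_pdivlMr// mulrC -[(mass s c)^-1]ger0_norm ?invr_ge0 ?(ltW m0)// -nuZ.
apply: inf_nu_le; exists s, (fun gamma => (mass s c)^-1 * c gamma); split => //; split => //.
by rewrite massZ ger0_norm ?invr_ge0 ?(ltW m0)// mulVf// gt_eqF.
Qed.

Let block_exists n (prev : seq (nat -> bool)) : exists b : seq (nat -> bool) * ((nat -> bool) -> R),
  unit_block (A0 `|` [set` prev]) b.1 b.2 /\ nu b.1 b.2 <= mu * (1 + (n.+1%:R ^+ 2)^-1).
Proof.
set A := _ `|` _; have cA : countable A.
  rewrite /A -bigcup2E; apply: bigcup_countable => // -[|[|?]] _ //=.
  exact/finite_set_countable/finite_seq.
have hinf : has_inf (block_norms A).
  by split; [exact: block_norms_nonempty|exists l => r /block_norms_bound/andP[]].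
have e0 : 0 < mu * (n.+1%:R ^+ 2)^-1 by rewrite mulr_gt0// invr_gt0 exprn_gt0.
have [r [s [c [Hb <-]]] nur] := inf_adherent e0 hinf.
exists (s, c); split => //; rewrite mulrDr mulr1 ltW//.
by move: nur; rewrite -/(inf_nu A) A0_stable//; exact: subsetUl.
Qed.

Lemma renormed_not_fpp_of_stable : ~ fixed_point_property (renormed N).
Proof.
have [pick pickP] : { pick : nat -> seq (nat -> bool) -> seq (nat -> bool) * ((nat -> bool) -> R) |
    forall n prev, unit_block (A0 `|` [set` prev]) (pick n prev).1 (pick n prev).2 /\
      nu (pick n prev).1 (pick n prev).2 <= mu * (1 + (n.+1%:R ^+ 2)^-1)}.
  exists (fun n prev => sval (cid (block_exists n prev))) => n prev.
  exact: svalP (cid (block_exists n prev)).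
pose acc := fix acc n := if n is m.+1 then acc m ++ (pick m (acc m)).1 else [::].
pose s n := (pick n (acc n)).1; pose c n := (pick n (acc n)).2.
have sP n : unit_block (A0 `|` [set` acc n]) (s n) (c n) by have [] := pickP n (acc n).
pose x n : renormed N := Psi (comb (s n) (c n)).
have accP n : uniq (acc n) /\ forall gamma, gamma \in acc n -> ~ A0 gamma.
  elim: n => [|n [un An]]; first by split.
  have [us sA _] := sP n; split.
    rewrite /= cat_uniq un us andbT /=; apply/hasPn => gamma gs.
    by apply/negP => ga; apply: (sA gamma gs); right.
  move=> gamma; rewrite /= mem_cat => /orP[/An//|/sA H Ag]; apply: H; by left.
have combine (a : nat -> R) M : exists d, comb (acc M) d =
     (fun i => \sum_(0 <= n < M) a n * comb (s n) (c n) i) /\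
    mass (acc M) d = \sum_(0 <= n < M) `|a n|.
  elim: M => [|M [d [dc dm]]].
    exists (fun=> 0); split; last by rewrite /mass /= big_nil big_geq.
    by apply/funext => i; rewrite /comb /= big_nil big_geq.
  have [us sA m1] := sP M.
  have notacc gamma : gamma \in s M -> (gamma \in acc M) = false.
    by move=> gs; apply/negP => ga; apply: (sA gamma gs); right.
  exists (fun gamma => if gamma \in acc M then d gamma else a M * c M gamma); split.
    apply/funext => i; rewrite big_nat_recr//= -combZ.
    rewrite -(congr1 (@^~ i) dc) /comb /= big_cat/=; congr (_ + _).
      by apply: eq_big_seq => gamma ->.
    by apply: eq_big_seq => gamma /notacc ->.
  rewrite big_nat_recr//= -dm -[`|a M|]mulr1 -m1 -massZ /mass /= big_cat/=; congr (_ + _).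
    by apply: eq_big_seq => gamma ->.
  by apply: eq_big_seq => gamma /notacc ->.
have xsum (a : nat -> R) M : \sum_(0 <= n < M) a n *: x n =
    Psi (fun i => \sum_(0 <= n < M) a n * comb (s n) (c n) i) :> V.
  elim: M => [|M IH].
    by rewrite big_geq// -Psi0; congr Psi; apply/funext => i; rewrite big_geq.
  rewrite big_nat_recr//= IH addrC.
  have [Psi_lin _ _] := PsiP; rewrite /x -Psi_lin; last 2 first.
  - exact: comb_bounded.
  - by have [d [<- _]] := combine a M; exact: comb_bounded.
  by congr Psi; apply/funext => i; rewrite big_nat_recr//= addrC.
apply: (asymptotic_ell1_not_fpp (x := x) mu_gt0).
- by move=> n; have [_] := pickP n (acc n).
- move=> a M; have [d [dc dm]] := combine a M.
  have [ua Aa] := accP M.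
  have := nu_ge_mu d ua Aa; rewrite dm /nu dc -xsum; exact.
- move=> t [r t0 tr].
  have [Psi_lin Psi_le _] := PsiP.
  have c1 n i : `|comb (s n) (c n) i| <= 1.
    by have [_ _ <-] := sP n; exact: norm_comb.
  pose y i n := t n * comb (s n) (c n) i.
  have y_cvg i : cvgn (series (y i)).
    apply: normed_cvg; apply: (series_le_cvg (v_ := t)) => //.
    - by move=> n /=.
    - by move=> n; rewrite /= /y normrM ger0_norm// ler_piMr.
    - apply: nondecreasing_is_cvgn; first by apply: nondecreasing_series => n _ _; exact: t0.
      by exists r => _ [M _ <-].
  pose z i := limn (series (y i)).
  have tail i M L : (forall M', \sum_(M <= n < M') t n <= L) -> `|z i - series (y i) M| <= L.
    move=> HL.
    have : `|series (y i) M' - series (y i) M| @[M' --> \oo] --> `|z i - series (y i) M|.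
      by apply: cvg_norm; apply: cvgB; [exact: y_cvg|exact: cvg_cst].
    move=> /cvgr_to_le; apply; near=> M'.
    have MM' : (M <= M')%N by near: M'; exact: nbhs_infty_ge.
    rewrite /series /= (big_cat_nat _ MM')//= addrAC subrr add0r.
    rewrite (le_trans (ler_norm_sum _ _ _))// (le_trans _ (HL M'))// ler_sum// => n _.
    by rewrite /y normrM ger0_norm// ler_piMr.
  have bz : bounded_family z.
    exists r => i; have := tail i 0%N r; rewrite /series /= big_geq// subr0; apply => M.
    exact: tr.
  apply: (cvg_series_dominated (t := t) (z := Psi z : renormed N) (r := r) (B := C)) => // M L HL.
  have L0 : 0 <= L by have := HL M; rewrite big_geq.
  have -> : (Psi z : renormed N) - series (fun n => t n *: x n) M =
      Psi (fun i => -1 * series (y i) M + z i) :> V.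
    rewrite Psi_lin//; last by have [d [<- _]] := combine t M; exact: comb_bounded.
    by rewrite scaleN1r addrC -xsum.
  have /andP[_ H] := eqnormP (Psi (fun i => -1 * series (y i) M + z i)).
  apply: (le_trans H); rewrite ler_pM2l//; apply: Psi_le => // i.
  by rewrite mulN1r addrC tail.
Unshelve. all: by end_near. Qed.

End blocks.

Lemma linfty_renormed_not_fpp : ~ fixed_point_property (renormed N).
Proof. by have [A0 [cA0 stA0]] := stable; exact: renormed_not_fpp_of_stable stA0. Qed.

End renorming.

Local Notation leb := completed_lebesgue_measure.

(** * The lattice norms of X and TX *)

Lemma bounded_linear_in_dual (R : realType) (E : normedModType R) (F : E -> R^o) (r : R) :
  linear F -> (forall x, `|F x| <= r * `|x|) -> F \in dual_pred (E := E).
Proof.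
move=> linF Fr; apply/dual_predP; split => // f.
apply/(@cvgrPdist_lt R R^o) => e e0; near=> g.
have -> : F f - F g = F (-1 *: g + f) by rewrite linF scaleN1r addrC.
rewrite (le_lt_trans (Fr _))// scaleN1r addrC.
have r1 : 0 < `|r| + 1 by rewrite ltr_wpDl.
apply: (@le_lt_trans _ _ ((`|r| + 1) * `|f - g|)).
  by rewrite ler_wpM2r// (le_trans (ler_norm r))// lerDl.
rewrite -ltr_pdivlMl// mulrC; near: g.
by apply: cvgr_dist_lt; rewrite ?divr_gt0//; exact: cvg_id.
Unshelve. all: by end_near. Qed.

Section lattice.
Variables (R : realType) (T : operator) (I : domain) (X : banachFunctionSpace R I).
Local Notation mu := (lebesgue_on R I).
Local Notation A f x := (averaging T I (fun t => `|f t|) x).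

Lemma ae_domain : {ae mu, forall x : lebesgueTypeR R, domain_set R I x /\ 0 < x}.
Proof.
apply/ae_lebesgue_onP.
have : {ae (@leb R), forall t : lebesgueTypeR R, t != 0}.
  exists [set 0]; split.
  - by apply: borel_lebesgue_measurable; exact: measurable_set1.
  - exact: (@lebesgue_measure_set1 R 0).
  - by move=> t /= /negP/negPn/eqP.
by apply: filterS => x x0 Ix; split=> //; rewrite lt_neqAle eq_sym x0 (domain_set_ge0 Ix).
Qed.

Lemma L0_of_measurable (F : lebesgueTypeR R -> R) :
  measurable_fun [set: lebesgueTypeR R] F ->
  exists f : L0 R I, {ae mu, forall x, f x = F x}.
Proof.
move=> mF.
pose mF' := isMeasurableFun.Build _ _ (lebesgueTypeR R) R F mF.
pose Fm : {mfun lebesgueTypeR R >-> R} :=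
  HB.pack_for {mfun lebesgueTypeR R >-> R} F mF'.
by exists (\pi_(L0 R I) Fm)%qT; exact: L0_pi.
Qed.

Lemma bfs_norm_le (u v : X) :
  {ae mu, forall x, `|(bfs_val u : L0 R I) x| <= `|(bfs_val v : L0 R I) x|} ->
  `|u| <= `|v|.
Proof. by move=> /bfs_ideal[h /bfs_val_inj ->]. Qed.

(** With [TX_dominates], the only access to the norm of [TX]: comparing T|f| almost
    everywhere with elements of [X]. *)
Lemma TX_dominated (f : L0 R I) (v : X) :
  {ae mu, forall x, (A f x <= `|(bfs_val v : L0 R I) x|%:E)%E} ->
  exists2 g : TX T X, TX_val g = f & `|g| <= `|v|.
Proof.
move=> fv.
pose h x := fine (A f x).
have mh : measurable_fun [set: lebesgueTypeR R] h.
  apply: measurableT_comp; first exact: fine_measurable.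
  exact: measurable_averaging.
have [H HE] := L0_of_measurable mh.
have AE : {ae mu, forall x : lebesgueTypeR R, A f x = (H x)%:E /\ 0 <= H x}.
  near=> x.
  have [Ix x0] : domain_set R I x /\ 0 < x by near: x; exact: ae_domain.
  have A0 : (0%R <= A f x)%E by exact: averaging_ge0.
  have Afv : (A f x <= `|(bfs_val v : L0 R I) x|%:E)%E by near: x.
  have HxE : A f x = (H x)%:E.
    by rewrite (near HE x)//= fineK// ge0_fin_numE// (le_lt_trans Afv)// ltry.
  by split => //; rewrite -lee_fin -HxE.
have [|w wH wv] := @bfs_ideal _ _ _ H v.
  by move: AE fv; apply: filterS2 => x [-> H0]; rewrite lee_fin (ger0_norm H0).
have fw : TX_image T f w.
  by rewrite /TX_image wH; apply: filterS AE => x [].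
have fP : f \in TX_pred T X by apply/TX_predP; exists w.
exists (MkTX fP) => //.
suff -> : `|MkTX fP| = `|w| by [].
by rewrite {1}/Num.norm /= /TX_norm (TX_image_inj (TX_TP (MkTX fP)) fw).
Unshelve. all: by end_near. Qed.

Lemma TX_dominates (g : TX T X) (v : X) :
  {ae mu, forall x, (`|(bfs_val v : L0 R I) x|%:E <= A g x)%E} -> `|v| <= `|g|.
Proof.
move=> vg; rewrite [leRHS](_ : _ = `|TX_T g|)//; apply: bfs_norm_le.
have := TX_TP g; rewrite /TX_image; move: vg; apply: filterS2 => x H E; move: H.
by rewrite E lee_fin => /le_trans; apply; exact: ler_norm.
Qed.

End lattice.

(** * A common form of the two operators *)

Section weights.
Variables (R : realType) (T : operator) (I : domain).
Local Notation mu := (lebesgue_on R I).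
Local Notation A f x := (averaging T I (fun t => `|f t|) x).
Local Notation D := (@averaging_set R T I).

(** The two operators have the common form of [averagingE]: the integral of
    [f / inner_weight] over [D x], times [outer_weight x]. *)
Definition inner_weight (t : R) : R := if T is Cesaro then 1 else t.
Definition outer_weight (x : R) : R := if T is Cesaro then x^-1 else 1.

Lemma inner_weight_gt0 t : 0 < t -> 0 < inner_weight t.
Proof. by rewrite /inner_weight; case: T. Qed.

Lemma outer_weight_gt0 t : 0 < t -> 0 < outer_weight t.
Proof. by rewrite /outer_weight; case: T; rewrite ?invr_gt0. Qed.

Lemma averagingE (f : R -> R) x :
  averaging T I f x = ((outer_weight x)%:E * \int[leb]_(t in D x) (f t / inner_weight t)%:E)%E.
Proof.
rewrite /outer_weight /averaging_set /inner_weight; case: T => /=; last by rewrite mul1e.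
by under [in RHS]eq_integral do rewrite divr1.
Qed.

Lemma measurable_averaging_set x : measurable (D x).
Proof.
rewrite /averaging_set; case: T; first by apply: borel_lebesgue_measurable; exact: measurable_itv.
apply: measurableI; first exact: measurable_domain_set.
by apply: borel_lebesgue_measurable; exact: measurable_itv.
Qed.

Lemma averaging_set_dom x t : domain_set R I x -> D x t -> domain_set R I t.
Proof.
rewrite /averaging_set; case: T => /= [|_ []//]; case: I => /=; rewrite !in_itv/=.
  by move=> /andP[? x1] /andP[-> tx] /=; exact: le_trans x1.
by move=> _ /andP[->].
Qed.

Lemma measurable_invr : measurable_fun [set: lebesgueTypeR R] (@GRing.inv R).
Proof.
apply: (@borel_lebesgue_measurable_fun R _ _ setT) => //.
have o0 : open (~` [set (0 : R)]).
  by apply: closed_openC; exact/accessible_closed_set1/hausdorff_accessible/norm_hausdorff.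
rewrite -(setvU [set (0 : R)]); apply/measurable_funU => //; first exact: open_measurable.
split; last exact: measurable_fun_set1.
apply: open_continuous_measurable_fun => // x; rewrite inE/= => /eqP x0.
exact: inv_continuous.
Qed.

Lemma measurable_idL : measurable_fun [set: lebesgueTypeR R] (fun x : lebesgueTypeR R => x : R).
Proof. by apply: (@borel_lebesgue_measurable_fun R _ _ setT). Qed.

Lemma measurable_inner_weight :
  measurable_fun [set: lebesgueTypeR R] (inner_weight : lebesgueTypeR R -> R).
Proof. by rewrite /inner_weight; case: T; [exact: measurable_cst|exact: measurable_idL]. Qed.

Lemma measurable_inner_weightV :
  measurable_fun [set: lebesgueTypeR R] (fun t : lebesgueTypeR R => (inner_weight t)^-1).
Proof. by rewrite /inner_weight; case: T; [exact: measurable_cst|exact: measurable_invr]. Qed.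

Lemma measurable_outer_weight :
  measurable_fun [set: lebesgueTypeR R] (outer_weight : lebesgueTypeR R -> R).
Proof. by rewrite /outer_weight; case: T; [exact: measurable_invr|exact: measurable_cst]. Qed.

End weights.

(** * Mass concentrated in a sequence of cells *)

(** The cells [J n] are consecutive: [D x] contains [J n] as soon as [x] is in
    [U n.+1], and meets it only if [x] is in [U n]. Hence the image under T of a
    function with mass 1 in [J n] lies between [u n.+1] and [u n], whose norms are
    all close to [phi]. *)
Section concentration.
Variables (R : realType) (T : operator) (I : domain) (X : banachFunctionSpace R I).
Local Notation mu := (lebesgue_on R I).
Local Notation A f x := (averaging T I (fun t => `|f t|) x).
Local Notation D := (@averaging_set R T I).
Local Notation omega := (@inner_weight R T).
Local Notation eta := (@outer_weight R T).

Variables (J : nat -> set (lebesgueTypeR R)) (len : nat -> R).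
Variables (U : nat -> set R) (u : nat -> X) (phi : R).
Hypothesis mJ : forall n, measurable (J n).
Hypothesis J_dom : forall n t, J n t -> domain_set R I t /\ 0 < t.
Hypothesis J_triv : trivIset setT J.
Hypothesis J_len : forall n, leb (J n) = (len n)%:E.
Hypothesis len_gt0 : forall n, 0 < len n.
Hypothesis U_dec : forall n m, (n <= m)%N -> U m `<=` U n.
Hypothesis J_in : forall n x, domain_set R I x -> 0 < x -> U n.+1 x -> J n `<=` D x.
Hypothesis J_out : forall n x t, domain_set R I x -> 0 < x -> J n t -> D x t -> U n x.
Hypothesis uE : forall n,
  {ae mu, forall x, (bfs_val (u n) : L0 R I) x = if `[< U n x >] then eta x else 0}.
Hypothesis phi_gt0 : 0 < phi.
Hypothesis phi_le : forall n, phi <= `|u n|.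
Hypothesis u_le : forall n, `|u n| <= phi * (1 + (n.+1%:R ^+ 2)^-1).

Let JJ := \bigcup_n J n.

Let mJJ : measurable JJ. Proof. exact: bigcup_measurable. Qed.

Definition step (y : nat -> R) (t : R) : R :=
  if pselect (exists n, J n t) is left Jt then y (projT1 (cid Jt)) else 0.

Let J_inj n m t : J n t -> J m t -> n = m.
Proof. by move=> nt mt; apply: (J_triv (i := n) (j := m)) => //; exists t. Qed.

Lemma stepE y n t : J n t -> step y t = y n.
Proof.
rewrite /step; case: pselect => [Jt nt|nJ nt]; last by exfalso; apply: nJ; exists n.
by case: cid => m /= mt; rewrite (J_inj mt nt).
Qed.

Lemma step0 y t : ~ JJ t -> step y t = 0.
Proof.
rewrite /step; case: pselect => [[n nt]|//] nJ; exfalso; apply: nJ.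
by exists n.
Qed.

Lemma step_linear (a : R) y z t :
  step (fun n => a * y n + z n) t = a * step y t + step z t.
Proof.
have [[n _ nt]|nJ] := pselect (JJ t); first by rewrite !(stepE _ nt).
by rewrite !step0// mulr0 addr0.
Qed.

Lemma measurable_step y : measurable_fun [set: lebesgueTypeR R] (step y : lebesgueTypeR R -> R).
Proof.
move=> _ Y mY; rewrite setTI.
rewrite (_ : _ @^-1` _ = (\bigcup_(n in [set n | Y (y n)]) J n) `|`
    ((if pselect (Y 0) then setT else set0) `&` ~` JJ)).
  apply: measurableU; first exact: bigcup_measurable.
  apply: measurableI; last exact: measurableC.
  by case: pselect => Y0 /=; [exact: measurableT|exact: measurable0].
apply/seteqP; split => t /=.
  have [[n _ nt]|nJ] := pselect (JJ t).
    by rewrite (stepE _ nt) => Yn; left; exists n.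
  by rewrite step0// => Y0; right; split => //; case: pselect.
move=> [[n Yn nt]|]; first by rewrite (stepE _ nt).
by case: pselect => Y0 [//= _ nJ]; rewrite step0.
Qed.

Let mw (f : {mfun lebesgueTypeR R >-> R}) :
  measurable_fun [set: lebesgueTypeR R] (fun t => f t / omega t).
Proof.
apply: measurable_funM; first exact: measurable_funPT.
exact: measurable_inner_weightV.
Qed.

Let mabs (f : {mfun lebesgueTypeR R >-> R}) (B : set (lebesgueTypeR R)) :
  measurable_fun B (fun t => (`|f t| / omega t)%:E).
Proof.
apply: measurable_funTS; apply/measurable_EFinP; apply: measurable_funM.
  by apply: measurableT_comp; exact: measurable_funPT.
exact: measurable_inner_weightV.
Qed.

Let J_omega n t : J n t -> 0 < omega t.
Proof. by move=> /J_dom[_ t0]; exact: inner_weight_gt0. Qed.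

Let D_omega x t : domain_set R I x -> 0 < x -> D x t -> 0 <= omega t.
Proof.
move=> Ix x0 /(averaging_set_dom Ix)/domain_set_ge0 t0.
by rewrite /inner_weight; case: T.
Qed.

Let partial_integral (f : {mfun lebesgueTypeR R >-> R}) N x :
  domain_set R I x -> 0 < x -> U N x ->
  (\sum_(0 <= n < N) \int[leb]_(t in J n) (`|f t| / omega t)%:E <=
   \int[leb]_(t in D x) (`|f t| / omega t)%:E)%E.
Proof.
move=> Ix x0 UN.
rewrite -ge0_integral_bigsetU//=; last 3 first.
- exact: iota_uniq.
- by apply: sub_trivIset J_triv.
- by move=> t; rewrite -bigcup_seq => -[n _ /J_omega w0]; rewrite lee_fin divr_ge0// ltW.
apply: ge0_subset_integral => //.
- by rewrite -bigcup_seq; apply: bigcup_measurable.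
- exact: measurable_averaging_set.
- by move=> t /(D_omega Ix x0) w0; rewrite lee_fin divr_ge0.
- rewrite -bigcup_seq => t [n /= + Jt]; rewrite mem_index_iota => /andP[_ nN].
  by apply: J_in Jt => //; exact: U_dec UN.
Qed.

Let integral_J_ge0 (f : {mfun lebesgueTypeR R >-> R}) n :
  (0 <= \int[leb]_(t in J n) (`|f t| / omega t)%:E)%E.
Proof. by apply: integral_ge0 => t /J_omega w0; rewrite lee_fin divr_ge0// ltW. Qed.

(** For [x] in [U N] the first [N] cells lie in [D x], so T|f| dominates their
    integral times [u N], and the norm of [u N] is at least [phi]: on the cells, the
    norm of [TX] dominates [phi] times an L1 norm. *)
Let integral_JJ_le (f : TX T X) :
  (\int[leb]_(t in JJ) (`|f t| / omega t)%:E <= (`|f| / phi)%:E)%E.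
Proof.
rewrite ge0_integral_bigcup//; last by move=> t [n _ /J_omega w0]; rewrite lee_fin divr_ge0// ltW.
apply: lime_le; first by apply: is_cvg_nneseries => n _ _; exact: integral_J_ge0.
apply: nearW => N; rewrite leNgt; apply/negP => fN.
set S := (\sum_(0 <= n < N) _)%E in fN.
have [r /andP[r1 r2]] : exists r, (`|f| / phi < r) && (r%:E <= S)%E.
  move: fN; case: S => [r|//|//]; first by rewrite lte_fin => ?; exists r; rewrite lexx andbT.
  by move=> _; exists (`|f| / phi + 1); rewrite leey andbT ltrDl.
have r0 : 0 <= r by rewrite (le_trans _ (ltW r1))// divr_ge0// ltW.
suff : `|r *: u N| <= `|f|.
  rewrite normrZ ger0_norm// leNgt => /negP; apply.
  by move: r1; rewrite ltr_pdivrMr// => /lt_le_trans; apply; rewrite ler_wpM2l.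
apply: TX_dominates; rewrite linearZ.
near=> x.
have [Ix x0] : domain_set R I x /\ 0 < x by near: x; exact: ae_domain.
rewrite (near (L0_scaleE r (bfs_val (u N))) x)// (near (uE N) x)//.
case: ifPn => [/asboolP UN|_]; last by rewrite mulr0 normr0 averaging_ge0.
rewrite averagingE normrM (ger0_norm r0) (gtr0_norm (outer_weight_gt0 T x0)) mulrC EFinM.
rewrite lee_pmul2l// ?lte_fin ?outer_weight_gt0//.
by apply: le_trans r2 _; exact: partial_integral.
Unshelve. all: by end_near. Qed.

Let mpair y (f : {mfun lebesgueTypeR R >-> R}) (B : set (lebesgueTypeR R)) :
  measurable_fun B (EFin \o (fun t => step y t * (f t / omega t))).
Proof.
apply: measurable_funTS; apply/measurable_EFinP.
by apply: measurable_funM; [exact: measurable_step|exact: mw].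
Qed.

Let integral_pair_le y (f : TX T X) r : (forall n, `|y n| <= r) ->
  (\int[leb]_(t in JJ) `|(step y t * (f t / omega t))%:E| <= (r * (`|f| / phi))%:E)%E.
Proof.
move=> yr; have r0 : 0 <= r by rewrite (le_trans _ (yr 0%N)).
apply: (@le_trans _ _ (\int[leb]_(t in JJ) (r%:E * (`|f t| / omega t)%:E))%E).
  apply: ge0_le_integral.
  - exact: mJJ.
  - by move=> t _; exact: abse_ge0.
  - apply: measurable_funTS; apply/measurable_EFinP.
    apply: measurableT_comp; first exact: measurable_funPT.
    by apply: measurable_funM; [exact: measurable_step|exact: mw].
  - by apply: emeasurable_funM; [exact: measurable_cst|exact: mabs].
  - move=> t [n _ Jt]; have w0 := J_omega Jt; rewrite (stepE _ Jt) -EFinM lee_fin.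
    by rewrite !normrM normfV (gtr0_norm w0) ler_wpM2r// divr_ge0// ltW.
rewrite (ge0_integralZl leb mJJ (@mabs f JJ)) ?lee_fin//; last first.
  by move=> t [n _ /J_omega w0]; rewrite lee_fin divr_ge0// ltW.
by rewrite EFinM lee_wpmul2l ?lee_fin.
Qed.

Let integrable_pair y (f : TX T X) : bounded_family y ->
  leb.-integrable JJ (EFin \o (fun t => step y t * (f t / omega t))).
Proof.
move=> [r yr]; apply/integrableP; split; first exact: mpair.
by rewrite (le_lt_trans (integral_pair_le f yr))// ltry.
Qed.

(** The factor [phi] makes the norm of this functional at most the supremum of
    [y], by [integral_JJ_le]. *)
Definition pairing y (f : TX T X) : R :=
  phi * \int[leb]_(t in JJ) (step y t * (f t / omega t)).

Let ae_JJ (P : R -> Prop) : {ae mu, forall x, P x} -> {ae leb, forall x, JJ x -> P x}.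
Proof.
by move=> /ae_lebesgue_onP; apply: filterS => t + [n _ /J_dom[It _]]; apply.
Qed.

Lemma pairing_linear y a (f g : TX T X) : bounded_family y ->
  pairing y (a *: f + g) = a * pairing y f + pairing y g.
Proof.
move=> by_; rewrite /pairing mulrCA -mulrDr; congr (_ * _).
have ipf := integrable_pair f by_; have ipg := integrable_pair g by_.
rewrite -(RintegralZl a mJJ ipf) -(RintegralD mJJ (integrableZl mJJ a ipf) ipg).
rewrite /Rintegral; congr fine; apply: ae_eq_integral.
- exact: mJJ.
- exact: mpair.
- have ms (h : {mfun lebesgueTypeR R >-> R}) :
      measurable_fun setT (fun t : lebesgueTypeR R => step y t * (h t / omega t)).
    by apply: measurable_funM; [exact: measurable_step|exact: mw].
  apply: measurable_funTS; apply/measurable_EFinP; apply: measurable_funD; last exact: ms.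
  by apply: measurable_funM; [exact: measurable_cst|exact: ms].
have := L0_addE (a *: TX_val f) (TX_val g); have := L0_scaleE a (TX_val f).
have E : TX_val (a *: f + g) = a *: TX_val f + TX_val g by [].
move=> /ae_JJ H1 /ae_JJ H2; move: H1 H2; apply: filterS2 => t H1 H2 Jt.
rewrite E; rewrite H2// H1//; congr EFin; ring.
Qed.

Lemma pairing_linear_l y z a f : bounded_family y -> bounded_family z ->
  pairing (fun n => a * y n + z n) f = a * pairing y f + pairing z f.
Proof.
move=> by_ bz; rewrite /pairing mulrCA -mulrDr; congr (_ * _).
have ipf := integrable_pair f by_; have ipg := integrable_pair f bz.
rewrite -(RintegralZl a mJJ ipf) -(RintegralD mJJ (integrableZl mJJ a ipf) ipg).
by apply: eq_Rintegral => t _; rewrite step_linear mulrDl -[in LHS]mulrA.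
Qed.

Lemma pairing_le y r f : (forall n, `|y n| <= r) -> `|pairing y f| <= r * `|f|.
Proof.
move=> yr; have by_ : bounded_family y by exists r.
rewrite /pairing normrM (gtr0_norm phi_gt0) -ler_pdivlMl// mulrC -mulrA.
rewrite (le_trans (le_normr_Rintegral mJJ (integrable_pair f by_)))//.
have H := integral_pair_le f yr.
rewrite -lee_fin /Rintegral fineK//; rewrite ge0_fin_numE ?(le_lt_trans H) ?ltry//.
by apply: integral_ge0 => t _; rewrite lee_fin.
Qed.

Lemma pairing_in_dual (y : nat -> R) : bounded_family y ->
  (pairing y : TX T X -> R^o) \in @dual_pred R (TX T X).
Proof.
move=> by_; have [r yr] := by_; apply: (bounded_linear_in_dual (r := r)).
  by move=> a f g; exact: pairing_linear.
by move=> f; exact: pairing_le.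
Qed.

(** The weight compensates the one in [averagingE], so that the integrals of
    [averagingE] are integrals of steps. *)
Definition represents (g : TX T X) y := {ae mu, forall x, g x = omega x * step y x}.

Lemma represents_inj f g y : represents f y -> represents g y -> f = g.
Proof.
move=> fy gy; apply: val_inj; apply/L0P; move: fy gy; apply: filterS2 => t -> ->.
by [].
Qed.

Lemma represents_linear a (f g : TX T X) y z : represents f y -> represents g z ->
  represents (a *: f + g) (fun n => a * y n + z n).
Proof.
move=> fy gz; have E : TX_val (a *: f + g) = a *: TX_val f + TX_val g by [].
have H1 := L0_addE (a *: TX_val f) (TX_val g); have H2 := L0_scaleE a (TX_val f).
rewrite /represents E; near=> t.
rewrite (near H1 t)// (near H2 t)// (near fy t)// (near gz t)// step_linear.
by ring.
Unshelve. all: by end_near. Qed.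

Let mstepA y (B : set (lebesgueTypeR R)) : measurable_fun B (fun t => `|step y t|%:E).
Proof.
apply: measurable_funTS; apply/measurable_EFinP.
by apply: measurableT_comp; [exact: measurable_funPT|exact: measurable_step].
Qed.

Let integral_step_le y x (b : nat -> R) L : domain_set R I x -> 0 < x ->
  (forall n t, J n t -> D x t -> `|y n| * len n <= b n) -> (forall n, 0 <= b n) ->
  (forall N, \sum_(0 <= n < N) b n <= L) ->
  (\int[leb]_(t in D x) `|step y t|%:E <= L%:E)%E.
Proof.
move=> Ix x0 yb b0 bL.
have mDx := measurable_averaging_set T I x.
have mDJ n : measurable (D x `&` J n) by exact: measurableI.
have -> : (\int[leb]_(t in D x) `|step y t|%:E =
    \int[leb]_(t in \bigcup_n (D x `&` J n)) `|step y t|%:E)%E.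
  rewrite -setI_bigcupr integral_mkcondr; apply: eq_integral => t _.
  rewrite patchE; case: ifPn => // /negP tJ.
  by rewrite step0 ?normr0// => Jt; apply: tJ; rewrite inE.
rewrite (ge0_integral_bigcup leb mDJ (@mstepA y _)); last 2 first.
  - by move=> t _; rewrite lee_fin.
  - by apply: trivIset_setIl.
apply: lime_le.
  by apply: is_cvg_nneseries => n _ _; apply: integral_ge0 => t _; rewrite lee_fin.
apply: nearW => N; apply: (@le_trans _ _ (\sum_(0 <= n < N) b n)%:E); last by rewrite lee_fin.
rewrite -sumEFin; apply: lee_sum => n _.
have [[t [Dt Jt]]|DJ0] := pselect (D x `&` J n !=set0); last first.
  by rewrite (_ : D x `&` J n = set0) ?integral_set0 ?lee_fin//; apply: contrapT => /eqP/set0P.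
rewrite (eq_integral (cst `|y n|%:E)); last first.
  by move=> s; rewrite inE => -[_ Js]; rewrite (stepE _ Js).
rewrite integral_cst// (@le_trans _ _ (`|y n| * len n)%:E) ?lee_fin ?(yb n t)//.
rewrite EFinM -J_len lee_wpmul2l ?lee_fin// le_measure ?inE//.
Qed.

(** If the cells of index less than [n0] carry no mass, then T of the step vanishes
    outside [U n0] and is elsewhere at most its total mass times [outer_weight], so it
    is dominated by a multiple of the single function [u n0]. In particular, infinite
    sums of steps are in [TX] by the ideal property alone. *)
Lemma step_in_TX y n0 L : (forall n, (n < n0)%N -> y n = 0) ->
  (forall N, \sum_(0 <= n < N) `|y n| * len n <= L) ->
  exists2 g, represents g y & `|g| <= L * `|u n0|.
Proof.
move=> y0 yL; have L_ge0 : 0 <= L by have := yL 0%N; rewrite big_geq.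
have mF : measurable_fun [set: lebesgueTypeR R] (fun t : lebesgueTypeR R => omega t * step y t).
  by apply: measurable_funM; [exact: measurable_inner_weight|exact: measurable_step].
have [f fE] := L0_of_measurable I mF.
suff dom : {ae mu, forall x : lebesgueTypeR R, (A f x <= `|(bfs_val (L *: u n0) : L0 R I) x|%:E)%E}.
  have [g gf gL] := TX_dominated dom.
  by exists g; [rewrite /represents gf|rewrite (le_trans gL)// normrZ ger0_norm].
have fleb := (ae_lebesgue_onP I _).1 fE.
rewrite linearZ; near=> x.
have [Ix x0] : domain_set R I x /\ 0 < x by near: x; exact: ae_domain.
rewrite (near (L0_scaleE L (bfs_val (u n0))) x)// (near (uE n0) x)//.
rewrite averagingE.
have -> : (\int[leb]_(t in D x) (`|f t| / omega t)%:E = \int[leb]_(t in D x) `|step y t|%:E)%E.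
  apply: ge0_ae_eq_integral.
  - exact: measurable_averaging_set.
  - exact: mabs.
  - exact: mstepA.
  - by move=> t /(D_omega Ix x0) w0; rewrite lee_fin divr_ge0.
  - by move=> t _; rewrite lee_fin.
  move: fleb; apply: filterS => t ft Dt.
  rewrite ft; last exact: averaging_set_dom Dt.
  have [[n _ /J_omega w0]|nJ] := pselect (JJ t); last by rewrite step0// mulr0 normr0 mul0r.
  by rewrite normrM (gtr0_norm w0) mulrAC divff ?mul1r// gt_eqF.
case: ifPn => [_|/asboolPn nU].
  rewrite normrM (ger0_norm L_ge0) (gtr0_norm (outer_weight_gt0 T x0)) mulrC EFinM.
  rewrite lee_wpmul2l ?lee_fin ?(ltW (outer_weight_gt0 T x0))//.
  apply: (integral_step_le (b := fun n => `|y n| * len n)) => // n.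
  by rewrite mulr_ge0// ltW.
rewrite mulr0 normr0 mule_ge0_le0 ?lee_fin ?(ltW (outer_weight_gt0 T x0))//.
apply: (integral_step_le (b := fun=> 0)) => //; last by move=> N; rewrite big1.
move=> n t Jt Dt; have [/y0 ->|n0n] := ltnP n n0; first by rewrite normr0 mul0r.
by exfalso; apply: nU; apply: (U_dec n0n); exact: J_out Dt.
Unshelve. all: by end_near. Qed.

Let unit_step n : nat -> R := fun k => (k == n)%:R / len n.

Lemma unit_exists : exists f : nat -> TX T X,
  forall n, represents (f n) (unit_step n) /\ `|f n| <= `|u n|.
Proof.
suff /choice[f fP] n : exists g : TX T X, represents g (unit_step n) /\ `|g| <= `|u n|.
  by exists f.
have [||g gr gn] := @step_in_TX (unit_step n) n 1.
- by move=> k kn; rewrite /unit_step (ltn_eqF kn) mul0r.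
- move=> N; rewrite (_ : \sum_(0 <= k < N) _ = (n < N)%:R); first by rewrite lern1 leq_b1.
  elim: N => [|N IH]; first by rewrite big_geq.
  rewrite big_nat_recr//= IH /unit_step normrM normr_nat ger0_norm ?invr_ge0 ?(ltW (len_gt0 n))//.
  rewrite ltnS; case: (ltngtP n N) => [_|_|<-]; rewrite ?mul0r ?addr0//.
  by rewrite mul1r mulVf ?add0r// gt_eqF.
by exists g; split => //; rewrite mul1r in gn.
Qed.

Lemma pairing_unit y n f : bounded_family y -> represents f (unit_step n) ->
  pairing y f = phi * y n.
Proof.
move=> by_ fn; rewrite /pairing; congr (_ * _).
have -> : \int[leb]_(t in JJ) (step y t * (f t / omega t)) =
    \int[leb]_(t in JJ `&` J n) (y n / len n).
  rewrite /Rintegral integral_mkcondr; congr fine.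
  apply: ae_eq_integral; [exact: mJJ|exact: mpair| |].
    apply: measurable_funTS; apply/(measurable_restrictT _ (mJ n)).
    exact: measurable_cst.
  move: (ae_JJ fn); apply: filterS => t ft JJt; rewrite ft// patchE.
  have [m _ Jm] := JJt; rewrite !(stepE _ Jm) mulrAC divff ?mul1r ?gt_eqF ?(J_omega Jm)//.
  case: ifPn => [|/negP nJ].
    by rewrite inE => Jn; rewrite (J_inj Jm Jn) /unit_step eqxx mul1r.
  rewrite /unit_step; case: eqP => [mn|_]; last by rewrite mul0r mulr0.
  by exfalso; apply: nJ; rewrite inE -mn.
rewrite (_ : JJ `&` J n = J n); last by apply/setIidPr => t Jt; exists n.
rewrite Rintegral_cst// [X in _ * X](_ : _ = len n); last exact: (congr1 fine (J_len n)).
by rewrite divfK// gt_eqF.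
Qed.

(** Every index has to occur on infinitely many cells, because the norm of a step of
    mass 1 in [J n] is close to [phi] for large [n] only. The value [k] of
    [logn 2 n.+1] is taken at n + 1 = 2^k (2 m + 1) for all m. *)
Let spread (S : countType) (y : S -> R) (n : nat) : R :=
  if unpickle (logn 2 n.+1) is Some i then y i else 0.

Let spread_often (S : countType) (y : S -> R) i m :
  exists2 n, (m <= n)%N & spread y n = y i.
Proof.
pose N := (2 ^ pickle i * (m.*2).+1)%N.
have N0 : (0 < N)%N by rewrite muln_gt0 expn_gt0.
exists N.-1.
  rewrite -ltnS prednK// /N -muln2 mulnC (leq_trans _ (leq_pmulr _ _)) ?expn_gt0//.
  by rewrite ltnS leq_pmulr.
rewrite /spread prednK// lognM ?expn_gt0// pfactorK// logn_coprime ?addn0 ?pickleK//.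
by rewrite coprime2n /= odd_double.
Qed.

Let spread_le (S : countType) (y : S -> R) r : 0 <= r -> (forall i, `|y i| <= r) ->
  forall n, `|spread y n| <= r.
Proof. by move=> r0 yr n; rewrite /spread; case: unpickle => [i|]; rewrite ?normr0. Qed.

Let spread_bounded (S : countType) (y : S -> R) : bounded_family y -> bounded_family (spread y).
Proof.
move=> [r yr]; exists `|r| => n; apply: spread_le => // i.
by rewrite (le_trans (yr i))// ler_norm.
Qed.

Lemma dual_linfty_embedding (S : countType) :
  exists Psi : (S -> R) -> dual (TX T X), linfty_embedding Psi.
Proof.
have [f fP] := unit_exists.
have /choice[Psi PsiP] (y : S -> R) : exists F : dual (TX T X),
    bounded_family y -> forall g, F g = pairing (spread y) g.
  have [by_|nb] := pselect (bounded_family y); last by exists 0.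
  by exists (MkDual (pairing_in_dual (spread_bounded by_))).
exists Psi; split.
- move=> a y z by_ bz; apply: val_inj; apply/funext => g.
  have -> : val (a *: Psi y + Psi z) g = a * Psi y g + Psi z g by [].
  transitivity (pairing (spread (fun i => a * y i + z i)) g).
    by apply: PsiP; exact: bounded_familyD.
  rewrite !PsiP// -pairing_linear_l; [|exact: spread_bounded..].
  congr (pairing _ _); apply/funext => n; rewrite /spread.
  by case: unpickle => // ; rewrite mulr0 addr0.
- move=> y r r0 yr; apply: dual_norm_le => g g1.
  rewrite PsiP; last by exists r.
  by rewrite (le_trans (pairing_le _ (spread_le r0 yr)))// ler_piMr.
- move=> y i by_; rewrite leNgt; apply/negP => yi.
  have yi0 : 0 < `|y i| - `|Psi y| by rewrite subr_gt0.
  have d0 : 0 < (`|y i| - `|Psi y|) / (`|Psi y| + 1) by rewrite divr_gt0// ltr_wpDl.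
  have [m _ mP] := near_infty_natSinv_lt (PosNum d0).
  have [n mn spn] := spread_often y i m.
  have nd : n.+1%:R^-1 < (`|y i| - `|Psi y|) / (`|Psi y| + 1) := mP n mn.
  have [fn un] := fP n.
  have := dual_norm_ge (Psi y) (f n); rewrite PsiP// (pairing_unit (spread_bounded by_) fn) spn.
  apply/negP; rewrite -ltNge.
  apply: (@le_lt_trans _ _ (`|Psi y| * (phi * (1 + (n.+1%:R ^+ 2)^-1)))).
    by apply: ler_wpM2l; [exact: dual_norm_ge0|exact: le_trans un (u_le n)].
  rewrite normrM (gtr0_norm phi_gt0) mulrCA ltr_pM2l// mulrDr mulr1 -ltrBrDl.
  apply: le_lt_trans (_ : (`|Psi y| + 1) * n.+1%:R^-1 < _); last by rewrite -ltr_pdivlMl// mulrC.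
  apply: ler_pM => //; first by rewrite lerDl.
  by rewrite lef_pV2 ?posrE ?exprn_gt0// -natrX ler_nat expnS leq_pmulr.
Qed.

(** The lower l1 estimate comes from the functional whose values on the cells are the
    signs of the coefficients. *)
Lemma TX_not_fpp : ~ fixed_point_property (TX T X).
Proof.
have [f fP] := unit_exists.
have represents_sum (a : nat -> R) N : represents (\sum_(0 <= n < N) a n *: f n)
    (fun k => if (k < N)%N then a k / len k else 0).
  elim: N => [|N IH].
    rewrite big_geq// /represents; have := L0_zeroE R I.
    apply: filterS => t H; rewrite [LHS]H -[RHS]/(omega t * step (fun=> 0) t).
    have [[n _ nt]|nJ] := pselect (JJ t); first by rewrite (stepE _ nt) mulr0.
    by rewrite step0// mulr0.
  rewrite big_nat_recr//= addrC.
  have := represents_linear (a N) (fP N).1 IH.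
  congr represents; apply/funext => k; rewrite /unit_step ltnS.
  by case: (ltngtP k N) => [_|_|->]; rewrite ?mul0r ?mulr0 ?add0r ?addr0// mul1r.
apply: (asymptotic_ell1_not_fpp (x := f) phi_gt0).
- by move=> n; rewrite (le_trans (fP n).2).
- move=> a N; pose y n := Num.sg (a n).
  have y1 n : `|y n| <= 1 by rewrite normr_sg lern1 leq_b1.
  have by_ : bounded_family y by exists 1.
  rewrite -[leRHS]mul1r (le_trans _ (pairing_le _ y1))// (le_trans _ (ler_norm _))//.
  suff -> : pairing y (\sum_(0 <= n < N) a n *: f n) = phi * \sum_(0 <= n < N) `|a n| by [].
  elim: N => [|N IH].
    rewrite !big_geq// mulr0; have := pairing_linear (-1) 0 0 by_.
    by rewrite scaler0 addr0 mulN1r addNr.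
  rewrite !big_nat_recr//= addrC pairing_linear// IH (pairing_unit by_ (fP N).1).
  by rewrite mulrDr addrC; congr (_ + _); rewrite mulrCA (mulrC (a N)) -normrEsg.
- move=> t [r t0 tr].
  have tail N L : (forall M, \sum_(N <= n < M) t n <= L) ->
      forall M, \sum_(0 <= k < M) `|-1 * (if (k < N)%N then t k / len k else 0) + t k / len k|
        * len k <= L.
    move=> HL M; have low k : (k < N)%N ->
        `|-1 * (if (k < N)%N then t k / len k else 0) + t k / len k| * len k = 0.
      by move=> ->; rewrite mulN1r addNr normr0 mul0r.
    have [MN|NM] := leqP M N.
      rewrite big_nat_cond big1.
        by have := HL N; rewrite big_geq.
      by move=> k /andP[/andP[_ kM] _]; apply: low; exact: leq_trans kM MN.
    rewrite (big_cat_nat _ (ltnW NM))//= [X in X + _]big_nat_cond [X in X + _]big1; last first.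
      by move=> k /andP[/andP[_ kN] _]; exact: low.
    rewrite add0r (le_trans _ (HL M))// big_nat_cond [leRHS]big_nat_cond.
    apply: ler_sum => k /andP[/andP[Nk _] _]; rewrite ltnNge Nk /= mulr0 add0r.
    by rewrite ger0_norm ?divr_ge0 ?(ltW (len_gt0 k))// divfK// gt_eqF.
  have [||z zr _] := @step_in_TX (fun k => t k / len k) 0 r; first by [].
    move=> N; apply: le_trans (tr N); apply: ler_sum => k _.
    by rewrite ger0_norm ?divr_ge0 ?(ltW (len_gt0 k))// divfK// gt_eqF.
  apply: (cvg_series_dominated (t := t) (z := z) (r := r) (B := `|u 0%N|)) => // N L HL.
  have [//|g gr gL] := step_in_TX (n0 := 0) _ (tail N L HL).
  have -> : z - series (fun n => t n *: f n) N = g; last by rewrite mulrC.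
  rewrite addrC -scaleN1r; apply: represents_inj gr.
  exact: represents_linear (represents_sum t N) zr.
Qed.

Lemma TX_and_dual_structure : ~ fixed_point_property (TX T X) /\
  forall S : countType, exists Psi : (S -> R) -> dual (TX T X), linfty_embedding Psi.
Proof. by split; [exact: TX_not_fpp|exact: dual_linfty_embedding]. Qed.

End concentration.

(** * Cells in the interior of the domain *)

Section cells.
Variables (R : realType) (T : operator) (I : domain) (X : banachFunctionSpace R I).
Local Notation mu := (lebesgue_on R I).
Local Notation A f x := (averaging T I (fun t => `|f t|) x).
Local Notation D := (@averaging_set R T I).
Local Notation omega := (@inner_weight R T).
Local Notation eta := (@outer_weight R T).

(** The order for which [D x] grows with [x]: increasing for the Cesaro
    operator, decreasing for the Copson operator. *)
Definition farther (x y : R) : bool := if T is Cesaro then x < y else y < x.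
Definition farther_eq (x y : R) : bool := if T is Cesaro then x <= y else y <= x.

Lemma farther_trans x y z : farther_eq x y -> farther_eq y z -> farther_eq x z.
Proof. by rewrite /farther_eq; case: T => xy yz; [exact: le_trans yz|exact: le_trans xy]. Qed.

Lemma fartherW x y : farther x y -> farther_eq x y.
Proof. by rewrite /farther /farther_eq; case: T => /ltW. Qed.

Lemma farther_eqxx x : farther_eq x x.
Proof. by rewrite /farther_eq; case: T. Qed.

Definition interior_point (x : R) := 0 < x /\ (I = unit_interval -> x < 1).

Lemma interior_domain x : interior_point x -> domain_set R I x.
Proof.
move=> [x0]; case: I => /= x1; rewrite in_itv/= ?andbT ?(ltW x0)//=.
exact/ltW/x1.
Qed.

Lemma interior_between a b x : interior_point a -> interior_point b ->
  a <= x <= b -> interior_point x.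
Proof.
move=> [a0 _] [_ b1] /andP[ax xb]; split; first exact: lt_le_trans ax.
by move=> /b1; exact: le_lt_trans.
Qed.

Lemma averaging_set_farther x y : farther_eq x y -> D x `<=` D y.
Proof.
rewrite /farther_eq /averaging_set; case: T => xy t /=.
  by rewrite !in_itv/= => /andP[-> /le_trans]; apply.
by rewrite !in_itv/= !andbT => -[? xt]; split => //; exact: le_trans xt.
Qed.

Lemma farther_exists p : interior_point p -> exists2 q, interior_point q & farther p q.
Proof.
rewrite /interior_point /farther => -[p0 p1]; case: T; last first.
  by exists (p / 2); [split=> [|/p1]|]; lra.
case: I p1 => p1; last first.
  by exists (p + 1); [split=> [|I1]; [lra|discriminate I1]|lra].
by exists ((p + 1) / 2); [split=> [|_]|]; have := p1 erefl; lra.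
Qed.

(** The interval is oriented, so that [y] is the farther end for both operators. *)
Definition cell (x y : R) : set (lebesgueTypeR R) :=
  if T is Cesaro then `]x, y[%classic else `]y, x[%classic.

Lemma measurable_cell x y : measurable (cell x y).
Proof. by rewrite /cell; case: T; apply: borel_lebesgue_measurable; exact: measurable_itv. Qed.

Lemma cellP x y t : cell x y t <-> farther x t && farther t y.
Proof. by rewrite /cell /farther; case: T; rewrite /= in_itv/= // andbC. Qed.

Lemma cell_measure x y : farther x y -> leb (cell x y) = `|x - y|%:E.
Proof.
rewrite /cell /farther; case: T => xy.
  have := lebesgue_measure_itv `]x, y[; rewrite /= lte_fin xy -EFinD => H.
  by rewrite ltr0_norm ?subr_lt0// opprB; exact: H.
have := lebesgue_measure_itv `]y, x[; rewrite /= lte_fin xy -EFinD => H.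
by rewrite gtr0_norm ?subr_gt0//; exact: H.
Qed.

Lemma cell_interior x y t : interior_point x -> interior_point y -> cell x y t ->
  interior_point t.
Proof.
move=> ix iy; rewrite /cell; case: T; rewrite /= in_itv/= => /andP[a b].
  by apply: (interior_between ix iy); rewrite !ltW.
by apply: (interior_between iy ix); rewrite !ltW.
Qed.

Lemma ae_cell (P : set R) x y : interior_point x -> interior_point y -> farther x y ->
  {ae mu, forall t, P t} -> exists2 t, cell x y t & P t.
Proof.
move=> ix iy xy aeP.
have sub : cell x y `<=` domain_set R I.
  by move=> t /(cell_interior ix iy)/interior_domain.
move: xy sub; rewrite /farther /cell; case: T => xy sub.
  by have [t txy Pt] := ae_lebesgue_on_itv xy sub aeP; exists t.
by have [t txy Pt] := ae_lebesgue_on_itv xy sub aeP; exists t.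
Qed.

Lemma cell_sub_averaging_set x y z : interior_point x -> interior_point y ->
  farther_eq y z -> cell x y `<=` D z.
Proof.
move=> ix iy yz t xyt; have it := cell_interior ix iy xyt.
move: xyt => /cellP/andP[_ ty].
apply: (averaging_set_farther (farther_trans (fartherW ty) yz)).
have [t0 _] := it; rewrite /averaging_set; case: T => /=; first by rewrite in_itv/= lexx ltW.
by split; [exact: interior_domain|rewrite in_itv/= lexx].
Qed.

Lemma cell_averaging_set_farther x y z t : cell x y t -> D z t -> farther_eq x z.
Proof.
move=> /cellP/andP[xt _]; rewrite /farther /farther_eq /averaging_set in xt *.
case: T xt => xt /=; rewrite ?in_itv/= ?andbT.
  by move=> /andP[_]; apply: le_trans; exact: ltW.
by move=> [_ zt]; rewrite (le_trans zt)// ltW.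
Qed.

(** Otherwise T|f| would vanish almost everywhere, and f with it. The point has to be
    interior in order to leave room for the cells beyond it. *)
Lemma interior_lower_bound (f : TX T X) : f != 0 ->
  exists p c, [/\ interior_point p, 0 < c &
    (c%:E <= \int[leb]_(t in D p) (`|f t| / omega t)%:E)%E].
Proof.
move=> f0; apply: contrapT => noc; move/eqP: f0; apply.
have G0 p : interior_point p -> (\int[leb]_(t in D p) (`|f t| / omega t)%:E = 0)%E.
  move=> ip; apply: contrapT => Gp; apply: noc.
  have : (0%R <= \int[leb]_(t in D p) (`|f t| / omega t)%:E)%E.
    apply: integral_ge0 => t Dt; rewrite lee_fin divr_ge0//.
    have := domain_set_ge0 (averaging_set_dom (interior_domain ip) Dt).
    by rewrite /inner_weight; case: T.
  move: Gp; case E : (\int[leb]_(t in D p) _)%E => [r| |]//.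
  - move=> r0; rewrite lee_fin le_eqVlt => /orP[/eqP rr|rp].
      by exfalso; apply: r0; rewrite -rr.
    by exists p, r; rewrite E; split.
  - by move=> _ _; exists p, 1; rewrite E leey; split.
apply: val_inj; apply/L0P.
have : {ae mu, forall x : lebesgueTypeR R, A f x = 0%E}.
  have : {ae (@leb R), forall t : lebesgueTypeR R, t != 1}.
    exists [set 1]; split.
    - by apply: borel_lebesgue_measurable; exact: measurable_set1.
    - exact: (@lebesgue_measure_set1 R 1).
    - by move=> t /= /negP/negPn/eqP.
  move=> H1; have {H1} : {ae mu, forall t : lebesgueTypeR R, t != 1}.
    by apply/ae_lebesgue_onP; apply: filterS H1.
  move: (ae_domain R I); apply: filterS2 => x [Ix x0] x1.
  rewrite averagingE G0 ?mule0//; split=> // I1; move: Ix; rewrite I1 /= in_itv/= => /andP[_ xle].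
  by rewrite lt_neqAle x1.
by move=> /averaging_ae_eq0; move: (L0_zeroE R I); apply: filterS2 => x -> ->.
Qed.

Section profile.
Variables (f : TX T X) (p c : R).
Hypothesis p_int : interior_point p.
Hypothesis c_gt0 : 0 < c.
Hypothesis f_lower : (c%:E <= \int[leb]_(t in D p) (`|f t| / omega t)%:E)%E.

(** [eta] cut off before [b]: the common shape of the images under T of the functions
    whose mass is concentrated near [b]. *)
Definition profile_of (b : R) (v : X) :=
  {ae mu, forall x, (bfs_val v : L0 R I) x = if farther_eq b x then eta x else 0}.

Lemma measurable_farther_eq (b : R) :
  measurable ([set x | farther_eq b x] : set (lebesgueTypeR R)).
Proof.
apply: borel_lebesgue_measurable; rewrite /farther_eq; case: T.
  have := @measurable_itv R `[b, +oo[; congr measurable.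
  by apply/seteqP; split => x /=; rewrite in_itv/= andbT.
by have := @measurable_itv R `]-oo, b]; congr measurable.
Qed.

(** Beyond [p] the function T|f|, which is in [X], is at least [c * eta]. *)
Lemma profile_exists b : farther_eq p b -> exists v, profile_of b v.
Proof.
move=> pb.
have mF : measurable_fun [set: lebesgueTypeR R]
    (fun x : lebesgueTypeR R => if farther_eq b x then eta x else 0).
  apply: measurable_fun_ifT; [|exact: measurable_outer_weight|exact: measurable_cst].
  apply: (measurable_fun_bool true); rewrite setTI; exact: measurable_farther_eq.
have [F FE] := L0_of_measurable I mF.
have [|v vF _] := @bfs_ideal R I X F (c^-1 *: TX_T f); last by exists v; rewrite /profile_of vF.
have fT := TX_TP f.
rewrite linearZ; near=> x.
have [Ix x0] : domain_set R I x /\ 0 < x by near: x; exact: ae_domain.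
rewrite (near FE x)// (near (L0_scaleE c^-1 (bfs_val (TX_T f))) x)//.
case: ifPn => bx; last by rewrite normr0.
rewrite (gtr0_norm (outer_weight_gt0 T x0)) normrM normfV (gtr0_norm c_gt0) ler_pdivlMl//.
rewrite (le_trans _ (ler_norm _))// -lee_fin -(near fT x)// averagingE mulrC EFinM.
rewrite lee_pmul2l ?lte_fin ?outer_weight_gt0//.
apply: le_trans f_lower _; apply: ge0_subset_integral.
- exact: measurable_averaging_set.
- exact: measurable_averaging_set.
- apply: measurable_funTS; apply/measurable_EFinP; apply: measurable_funM.
    by apply: measurableT_comp; exact: measurable_funPT.
  exact: measurable_inner_weightV.
- move=> t Dt; rewrite lee_fin divr_ge0//.
  have := domain_set_ge0 (averaging_set_dom Ix Dt).
  by rewrite /inner_weight; case: T.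
- by apply: averaging_set_farther; exact: farther_trans bx.
Unshelve. all: by end_near. Qed.

Lemma profile_norm_le b d v w : farther_eq b d -> profile_of b v -> profile_of d w -> `|w| <= `|v|.
Proof.
move=> bd bv dw; apply: bfs_norm_le; move: bv dw; apply: filterS2 => x -> ->.
case: ifPn => [dx|_]; last by rewrite normr0.
by rewrite (farther_trans bd dx).
Qed.

Lemma profile_norm_gt0 b v : interior_point b -> profile_of b v -> 0 < `|v|.
Proof.
move=> ib bv; rewrite normr_gt0; apply/eqP => v0.
have [d id bd] := farther_exists ib.
have : {ae mu, forall x, (if farther_eq b x then eta x else 0) = 0}.
  have := bv; rewrite /profile_of v0 linear0; move: (L0_zeroE R I).
  by apply: filterS2 => x -> <-.
move=> /(ae_cell ib id bd)[x bdx].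
have ix := cell_interior ib id bdx; move: bdx => /cellP/andP[/fartherW -> _].
by apply/eqP; rewrite gt_eqF// outer_weight_gt0//; case: ix.
Qed.

(** The norms of the profiles decrease along a sequence of points from [p] to a
    farther interior point [q], and stay above the norm of the profile at [q]; so they
    converge to some [phi > 0], at any rate along a subsequence. No continuity of the
    norm is involved: the limit need not be the norm of the profile at [q]. *)
Lemma profile_sequence : exists (beta : nat -> R) (u : nat -> X) (phi : R),
  [/\ forall n, interior_point (beta n), forall n m, (n < m)%N -> farther (beta n) (beta m),
      forall n, profile_of (beta n) (u n), 0 < phi &
      forall n, phi <= `|u n| <= phi * (1 + (n.+1%:R ^+ 2)^-1)].
Proof.
have [q q_int pq] := farther_exists p_int.
pose b (n : nat) := q + (p - q) / n.+1%:R.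
have b_lt n m : (n < m)%N -> farther (b n) (b m).
  move=> nm; have nm' : m.+1%:R^-1 < n.+1%:R^-1 :> R.
    by rewrite ltf_pV2 ?posrE// ltr_nat.
  move: pq; rewrite /farther /b; case: T => pq; rewrite ltrD2l.
    by rewrite ltr_nM2l// subr_lt0.
  by rewrite ltr_pM2l// subr_gt0.
have b_le n m : (n <= m)%N -> farther_eq (b n) (b m).
  rewrite leq_eqVlt => /orP[/eqP ->|/b_lt/fartherW//]; exact: farther_eqxx.
have b0 : b 0%N = p by rewrite /b divr1 addrC subrK.
have b_q n : farther (b n) q.
  move: pq; rewrite /farther /b; case: T => pq.
    by rewrite gtrDl pmulr_llt0 ?invr_gt0// subr_lt0.
  by rewrite ltrDl divr_gt0// subr_gt0.
have pb n : farther_eq p (b n) by rewrite -b0; exact: b_le.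
have b_int n : interior_point (b n).
  have := pb n; have := fartherW (b_q n); rewrite /farther_eq; case: T => bq pb'.
    by apply: (interior_between p_int q_int); rewrite pb' bq.
  by apply: (interior_between q_int p_int); rewrite pb' bq.
have /choice[v vP] n : exists v, profile_of (b n) v by exact: profile_exists.
have [w wP] := profile_exists (fartherW pq).
have w0 := profile_norm_gt0 q_int wP.
have v_noninc : nonincreasing_seq (fun n => `|v n|).
  by move=> n m /b_le nm; exact: profile_norm_le (vP n) (vP m).
have v_ge n : `|w| <= `|v n| by exact: profile_norm_le (fartherW (b_q n)) (vP n) wP.
have v_cvg : cvgn (fun n => `|v n|).
  by apply: nonincreasing_is_cvgn => //; exists `|w| => _ [n _ <-].
pose phi := limn (fun n => `|v n|).
have phi_le n : phi <= `|v n| by exact: (nonincreasing_cvgn_ge v_noninc v_cvg n).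
have phi_gt0 : 0 < phi.
  by apply: (lt_le_trans w0); apply: (cvgr_to_ge v_cvg); apply: nearW.
have /choice[g gP] n : exists N, forall m, (N <= m)%N ->
    `|v m| <= phi * (1 + (n.+1%:R ^+ 2)^-1).
  have lt_phi : phi < phi * (1 + (n.+1%:R ^+ 2)^-1).
    by rewrite ltr_pMr// ltrDl invr_gt0 exprn_gt0.
  by have [N _ NP] := cvgr_le _ v_cvg _ lt_phi; exists N => m Nm; exact: NP.
pose sigma := fix sigma n := if n is m.+1 then maxn (sigma m).+1 (g n) else g 0%N.
have sigma_ge n : (g n <= sigma n)%N by case: n => //= n; exact: leq_maxr.
have sigma_lt n m : (n < m)%N -> (sigma n < sigma m)%N.
  elim: m => // m IH; rewrite ltnS leq_eqVlt => /orP[/eqP ->|/IH nm].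
    exact: leq_maxl.
  by apply: leq_trans (leq_maxl _ _); rewrite ltnS ltnW.
exists (b \o sigma), (v \o sigma), phi; split.
- by move=> n; exact: b_int.
- by move=> n m /sigma_lt; exact: b_lt.
- by move=> n; exact: vP.
- exact: phi_gt0.
- by move=> n; rewrite /= phi_le gP.
Qed.

End profile.

Lemma TX_structure : (exists f : TX T X, f != 0) ->
  ~ fixed_point_property (TX T X) /\
  forall S : countType, exists Psi : (S -> R) -> dual (TX T X), linfty_embedding Psi.
Proof.
move=> [f /interior_lower_bound[p [c [p_int c0 fc]]]].
have [beta [u [phi [b_int b_lt uP phi_gt0 phiP]]]] := profile_sequence p_int c0 fc.
have b_le n m : (n <= m)%N -> farther_eq (beta n) (beta m).
  rewrite leq_eqVlt => /orP[/eqP ->|/b_lt/fartherW//]; exact: farther_eqxx.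
have farther_asym x y : farther x y -> farther_eq y x -> False.
  rewrite /farther /farther_eq; case: T => xy yx.
    by have := lt_le_trans xy yx; rewrite ltxx.
  by have := le_lt_trans yx xy; rewrite ltxx.
apply: (@TX_and_dual_structure R T I X (fun n => cell (beta n) (beta n.+1))
  (fun n => `|beta n - beta n.+1|) (fun n => [set x | farther_eq (beta n) x]) u phi).
- by move=> n; exact: measurable_cell.
- move=> n t /(cell_interior (b_int n) (b_int n.+1)) it.
  by split; [exact: interior_domain|case: it].
- have disj n m t : (n < m)%N -> cell (beta n) (beta n.+1) t ->
      cell (beta m) (beta m.+1) t -> False.
    move=> nm /cellP/andP[_ t1] /cellP/andP[t2 _].
    exact: farther_asym t1 (farther_trans (b_le _ _ nm) (fartherW t2)).
  move=> n m _ _ [t [tn tm]]; case: (ltngtP n m) => // nm.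
    by exfalso; exact: disj nm tn tm.
  by exfalso; exact: disj nm tm tn.
- by move=> n; apply: cell_measure; exact: b_lt.
- move=> n; rewrite normr_gt0 subr_eq0; apply/eqP => E.
  by have := b_lt n n.+1 (ltnSn n); rewrite -E => /farther_asym; apply; exact: farther_eqxx.
- by move=> n m /b_le nm x /=; exact: farther_trans.
- by move=> n x Ix x0 /= bx; exact: (cell_sub_averaging_set (b_int n) (b_int n.+1) bx).
- by move=> n x t Ix x0 tn tx /=; exact: cell_averaging_set_farther tn tx.
- by move=> n; have := uP n; apply: filterS => x ->; rewrite asboolb.
- exact: phi_gt0.
- by move=> n; have /andP[] := phiP n.
- by move=> n; have /andP[] := phiP n.
Qed.

End cells.

Theorem theorem7p1 (R : realType) (T : operator) (I : domain)
    (X : banachFunctionSpace R I) (TX_neq0 : exists f : TX T X, f != 0) :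
  ~ fixed_point_property (TX T X) /\
  (forall N : equivalent_norm (dual (TX T X)),
     ~ fixed_point_property (renormed N)) /\
  ~ weak_fixed_point_property (dual (TX T X)).
Proof.
have [nfpp /(_ (nat * seq (seq bool))%type)[Psi PsiP]] := TX_structure TX_neq0.
split=> //; split; last exact: linfty_not_weak_fpp PsiP.
by move=> N; exact: linfty_renormed_not_fpp PsiP N.
Qed.
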